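(* Consider the problem $\min_{\mathbf{x}\in\mathbb{R}^m} f(\mathbf{x})=\frac1N\sum_{i=1}^N f_i(\mathbf{x})$ with $f_i(\mathbf{x})=\mathbb{E}_{\zeta_i\sim\mathcal{D}_i}[F_i(\mathbf{x};\zeta_i)]$, satisfying the smoothness (modulus $L$), bounded variance ($\sigma^2$) and bounded second moment ($G^2$) assumptions stated in the context. Let $\mathbf{x}_i^t$ be the iterates of Parallel Restarted SGD (described in the context) with learning rate $\gamma$ and synchronization interval $I$ (a positive integer), and let $\overline{\mathbf{x}}^t=\frac1N\sum_{i=1}^N\mathbf{x}_i^t$. If $0<\gamma\le\frac1L$, then for all $T\ge1$, $$\frac1T\sum_{t=1}^T\mathbb{E}\left[\Vert\nabla f(\overline{\mathbf{x}}^{t-1})\Vert^2\right]\le\frac{2}{\gamma T}\left(f(\overline{\mathbf{x}}^0)-f^\ast\right)+4\gamma^2I^2G^2L^2+\frac{L}{N}\gamma\sigma^2,$$ where $f^\ast$ is the minimum value of $f$ over $\mathbb{R}^m$.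
   Context: Problem. $N\ge1$ is the number of workers; for $i\in\{1,\dots,N\}$, $\mathcal{D}_i$ is a probability distribution (possibly different for different $i$), $f_i(\mathbf{x})=\mathbb{E}_{\zeta_i\sim\mathcal{D}_i}[F_i(\mathbf{x};\zeta_i)]$ is a smooth, possibly non-convex function on $\mathbb{R}^m$, and $f=\frac1N\sum_{i=1}^N f_i$. Its minimum value is denoted $f^\ast$. $\Vert\cdot\Vert$ is the Euclidean norm and $\nabla F_i(\mathbf{x};\zeta)$ is the gradient in $\mathbf{x}$. Stochastic gradients. At iteration $t\ge1$, worker $i$ observes $\mathbf{G}_i^t=\nabla F_i(\mathbf{x}_i^{t-1};\zeta_i^t)$, where the samples $\zeta_i^t\sim\mathcal{D}_i$ are independent across workers $i$ and iterations $t$. The stochastic gradients are unbiased: $\mathbb{E}[\mathbf{G}_i^t\mid\boldsymbol{\zeta}^{[t-1]}]=\nabla f_i(\mathbf{x}_i^{t-1})$, where $\boldsymbol{\zeta}^{[t-1]}$ denotes all samples $\zeta_j^\tau$ with $1\le j\le N$ and $1\le\tau\le t-1$. Assumptions. (1) Smoothness: each $f_i$ is differentiable and smooth with modulus $L>0$, i.e. $\Vert\nabla f_i(\mathbf{x})-\nabla f_i(\mathbf{y})\Vert\le L\Vert\mathbf{x}-\mathbf{y}\Vert$ for all $\mathbf{x},\mathbf{y}$. (2) There exist constants $\sigma>0$, $G>0$ such that for all $\mathbf{x}$ and all $i$: $\mathbb{E}_{\zeta_i\sim\mathcal{D}_i}\Vert\nabla F_i(\mathbf{x};\zeta_i)-\nabla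 f_i(\mathbf{x})\Vert^2\le\sigma^2$ and $\mathbb{E}_{\zeta_i\sim\mathcal{D}_i}\Vert\nabla F_i(\mathbf{x};\zeta_i)\Vert^2\le G^2$. Parallel Restarted SGD (PR-SGD). Input: learning rate $\gamma>0$, integer $I>0$, and a common deterministic initial point $\mathbf{x}_i^0=\overline{\mathbf{y}}\in\mathbb{R}^m$ for all $i$. For $t=1,\dots,T$: each worker $i$ observes $\mathbf{G}_i^t$ at the point $\mathbf{x}_i^{t-1}$; if $t$ is a multiple of $I$, compute $\overline{\mathbf{y}}=\frac1N\sum_{i=1}^N\mathbf{x}_i^{t-1}$ and set $\mathbf{x}_i^t=\overline{\mathbf{y}}-\gamma\mathbf{G}_i^t$ for all $i$; otherwise set $\mathbf{x}_i^t=\mathbf{x}_i^{t-1}-\gamma\mathbf{G}_i^t$ for all $i$. *)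

(* Defs.v *)
From HB Require Import structures.
From mathcomp Require Import all_boot all_order all_algebra.
From mathcomp Require Import all_classical all_reals all_analysis.

Set Implicit Arguments.
Unset Strict Implicit.
Unset Printing Implicit Defensive.

Import Order.TTheory GRing.Theory Num.Theory.
Import numFieldNormedType.Exports.

Local Open Scope classical_set_scope.
Local Open Scope ring_scope.

(* The library norm [`|v|] on row vectors is the sup norm. It induces the same
   topology, hence the same notion of differentiability, as [enorm]. *)
Definition enorm (R : realType) (m : nat) (v : 'rV[R]_m) : R :=
  Num.sqrt (\sum_(j < m) v 0 j ^+ 2).

Definition grad (R : realType) (m : nat) (f : 'rV[R]_m -> R) (x : 'rV[R]_m) :
    'rV[R]_m :=
  \row_(j < m) 'D_(delta_mx 0 j) f x.

Definition is_minimum_value (R : realType) (T : Type) (f : T -> R) (v : R) : Prop :=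
  (exists x, f x = v) /\ (forall x, v <= f x).

Definition average (R : realType) (N m : nat) (x : 'I_N -> 'rV[R]_m) : 'rV[R]_m :=
  N%:R^-1 *: \sum_(i < N) x i.

Definition local_loss (R : realType) (N m : nat) (d : 'I_N -> measure_display)
    (Z : forall i, measurableType (d i)) (D : forall i, probability (Z i) R)
    (F : forall i, 'rV[R]_m -> Z i -> R) (i : 'I_N) (x : 'rV[R]_m) : R :=
  fine 'E_(D i)[F i x]%E.

Definition global_loss (R : realType) (N m : nat) (d : 'I_N -> measure_display)
    (Z : forall i, measurableType (d i)) (D : forall i, probability (Z i) R)
    (F : forall i, 'rV[R]_m -> Z i -> R) (x : 'rV[R]_m) : R :=
  N%:R^-1 * \sum_(i < N) local_loss D F i x.

(* [prsgd F gamma I y z t i] is the iterate of worker [i] after iteration [t]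
   along one realization [z] of the samples; [z i t] is the sample drawn by
   worker [i] at iteration [t >= 1], and [z i 0] is never used. *)
Fixpoint prsgd (R : realType) (N m : nat) (Z : 'I_N -> Type)
    (F : forall i, 'rV[R]_m -> Z i -> R) (gamma : R) (I : nat) (y : 'rV[R]_m)
    (z : forall i : 'I_N, nat -> Z i) (t : nat) : 'I_N -> 'rV[R]_m :=
  if t is s.+1 then
    let x := prsgd F gamma I y z s in
    fun i => (if (I %| s.+1)%N then average x else x i)
             - gamma *: grad (fun u => F i u (z i s.+1)) (x i)
  else fun=> y.

Definition mutually_independent (R : realType) (dO : measure_display)
    (Omega : measurableType dO) (P : probability Omega R)
    (K : choiceType) (J : set K) (d : K -> measure_display)
    (S : forall k, measurableType (d k)) (X : forall k, Omega -> S k) : Prop :=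
  forall s : seq K, uniq s -> (forall k, k \in s -> J k) ->
  forall A : forall k, set (S k), (forall k, measurable (A k)) ->
    P (\bigcap_(k in [set` s]) (X k @^-1` A k)) =
    (\prod_(k <- s) P (X k @^-1` A k))%E.

(* The sigma-algebra generated by the samples of iterations [1, ..., t - 1]. *)
Definition past_sigma (dO : measure_display) (Omega : measurableType dO)
    (N : nat) (d : 'I_N -> measure_display) (Z : forall i, measurableType (d i))
    (zeta : forall i : 'I_N, nat -> Omega -> Z i) (t : nat) : set (set Omega) :=
  <<s [set A | exists (j : 'I_N) (tau : nat) (B : set (Z j)),
         [/\ (1 <= tau < t)%N, measurable B & A = zeta j tau @^-1` B]] >>.

(* [Y] is a version of the conditional expectation of [X] given the
   sub-sigma-algebra [H]. *)
Definition is_cond_expectation (R : realType) (dO : measure_display)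
    (Omega : measurableType dO) (P : probability Omega R)
    (H : set (set Omega)) (X Y : Omega -> R) : Prop :=
  [/\ P.-integrable setT (EFin \o X),
      P.-integrable setT (EFin \o Y),
      (forall B : set R, measurable B -> H (Y @^-1` B)) &
      (forall A, H A ->
         (\int[P]_(w in A) (X w)%:E = \int[P]_(w in A) (Y w)%:E)%E)].

(* Main.v *)
Require Import Defs.
From HB Require Import structures.
From mathcomp Require Import all_boot all_order all_algebra.
From mathcomp Require Import all_classical all_reals all_analysis.
From mathcomp Require Import measurable_realfun ring lra.

Set Implicit Arguments.
Unset Strict Implicit.
Unset Printing Implicit Defensive.

Import Order.TTheory GRing.Theory Num.Theory.
Import numFieldNormedType.Exports.

Local Open Scope classical_set_scope.
Local Open Scope ring_scope.

(** The mean iterate xbar performs gradient descent with the inexact gradient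
    average_i g_i, where g_i is the stochastic gradient of worker i at its own
    iterate x_i. Write g_i = grad f_i(x_i) + e_i with noise e_i. Smoothness of f
    and gamma <= 1/L give, along every realization ([one_step]),

      (gamma/2) |grad f(xbar)|^2 <= f(xbar) - f(xbar_next)
        + (gamma L^2 / 2) mean_i |xbar - x_i|^2 + V . ebar
        + (L gamma^2 / 2) |ebar|^2

    where ebar is the mean noise and V depends on earlier samples only. Summed
    over the iterations the values of f telescope, and f at the last mean
    iterate is at least its minimum ([pathwise_bound]): summing before taking
    expectations leaves f at the deterministic starting point only. In
    expectation three error terms remain.

    - Spread. Since the last averaging every worker has made at most I steps
      from a common point, so the mean squared deviation from xbar is at most
      gamma^2 I times the sum over these steps of the mean squared stochastic
      gradient, hence at most gamma^2 I^2 G^2 in expectation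
      ([prsgd_spread], [window_sum_mean]).
    - Linear noise term. It vanishes in expectation, because the noise of
      worker i is orthogonal to every square-integrable function of the other
      samples drawn so far ([noise_orthogonal]).
    - Quadratic noise term. By the same orthogonality distinct workers have
      uncorrelated noise, so E |ebar|^2 <= sigma^2 / N
      ([average_noise_second_moment]).

    The probabilistic input is that the sample of worker i at iteration t is
    independent of the sigma-algebra H of all other samples up to t
    ([independent_generated_by]), while the point x_i at which it is used is
    H-measurable. Fubini's theorem for the product law then integrates over the
    fresh sample with the point frozen ([ge0_integral_freeze],
    [integral_freeze]): the moment bounds, assumed at fixed points, pass to the
    iterates, and unbiasedness, assumed given the earlier iterations, says that
    the frozen mean of the noise vanishes almost surely, a statement that is
    insensitive to the samples of the other workers at t. Frozen integrands
    have to be jointly measurable: a gradient is a limit of difference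
    quotients, and these are continuous in the point and measurable in the
    sample ([measurable_caratheodory], [measurable_grad]). *)

(** * Euclidean geometry of row vectors *)

Definition dot (R : realType) (m : nat) (u v : 'rV[R]_m) : R :=
  \sum_(j < m) u 0 j * v 0 j.

Section InnerProduct.
Context {R : realType} {m : nat}.
Implicit Types u v w : 'rV[R]_m.

Lemma subr_entry u v j : (u - v) 0 j = u 0 j - v 0 j.
Proof. by rewrite !mxE. Qed.

Lemma scaler_entry a u j : (a *: u) 0 j = a * u 0 j.
Proof. by rewrite mxE. Qed.

Lemma dotC u v : dot u v = dot v u.
Proof. by apply: eq_bigr => j _; rewrite mulrC. Qed.

Lemma dotDl u v w : dot (u + v) w = dot u w + dot v w.
Proof.
by rewrite /dot -big_split /=; apply: eq_bigr => j _; rewrite mxE mulrDl.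
Qed.

Lemma dotZl a u v : dot (a *: u) v = a * dot u v.
Proof.
by rewrite /dot mulr_sumr; apply: eq_bigr => j _; rewrite mxE mulrA.
Qed.

Lemma dotNl u v : dot (- u) v = - dot u v.
Proof. by rewrite -scaleN1r dotZl mulN1r. Qed.

Lemma dotBl u v w : dot (u - v) w = dot u w - dot v w.
Proof. by rewrite dotDl dotNl. Qed.

Lemma dotDr u v w : dot w (u + v) = dot w u + dot w v.
Proof. by rewrite dotC dotDl !(dotC w). Qed.

Lemma dotZr a u v : dot u (a *: v) = a * dot u v.
Proof. by rewrite dotC dotZl dotC. Qed.

Lemma dotNr u v : dot u (- v) = - dot u v.
Proof. by rewrite dotC dotNl dotC. Qed.

Definition dotE := (dotDl, dotDr, dotNl, dotNr, dotZl, dotZr).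

Lemma dot_suml n (u : 'I_n -> 'rV[R]_m) v :
  dot (\sum_i u i) v = \sum_i dot (u i) v.
Proof.
rewrite /dot exchange_big; apply: eq_bigr => j _.
by rewrite summxE mulr_suml.
Qed.

Lemma dot_ge0 v : 0 <= dot v v.
Proof. by apply: sumr_ge0 => j _; rewrite -expr2 sqr_ge0. Qed.

Lemma sqr_entry_le_dot v j : v 0 j ^+ 2 <= dot v v.
Proof.
rewrite /dot (bigD1 j)//= -expr2 lerDl sumr_ge0// => k _.
by rewrite -expr2 sqr_ge0.
Qed.

Lemma sqr_enorm v : enorm v ^+ 2 = dot v v.
Proof.
rewrite /enorm sqr_sqrtr; last by apply: sumr_ge0 => j _; rewrite sqr_ge0.
by apply: eq_bigr => j _; rewrite expr2.
Qed.

(** Nonnegativity of |u - c v|^2 gives 2 c u.v <= |u|^2 + c^2 |v|^2. *)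
Lemma dot_le_of_enorm u v c : 0 < c -> enorm u <= c * enorm v ->
  dot u v <= c * dot v v.
Proof.
move=> c0 uv; have : enorm u ^+ 2 <= (c * enorm v) ^+ 2.
  by rewrite ler_sqr ?nnegrE ?mulr_ge0 ?sqrtr_ge0// ltW.
rewrite exprMn !sqr_enorm => uuvv.
have := dot_ge0 (u - c *: v); rewrite !dotE (dotC v u) => h.
rewrite -(ler_pM2l c0); nra.
Qed.

(** The difference of the two sides is |u - 2 v|^2. *)
Lemma dot_sub_le u v : dot u u <= 2 * dot (u - v) (u - v) + 2 * dot v v.
Proof.
have := dot_ge0 (u - 2 *: v); rewrite !dotE (dotC v u); lra.
Qed.

End InnerProduct.

Section Averages.
Context {R : realType} {N m : nat}.
Implicit Types x y : 'I_N -> 'rV[R]_m.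

Lemma averageD x y : average (fun i => x i + y i) = average x + average y.
Proof. by rewrite /average big_split scalerDr. Qed.

Lemma averageZ a x : average (fun i => a *: x i) = a *: average x.
Proof.
by rewrite /average -scaler_sumr !scalerA mulrC.
Qed.

Lemma averageN x : average (fun i => - x i) = - average x.
Proof. by rewrite /average sumrN scalerN. Qed.

Lemma averageB x y : average (fun i => x i - y i) = average x - average y.
Proof. by rewrite averageD averageN. Qed.

Lemma eq_average x y : (forall i, x i = y i) -> average x = average y.
Proof. by move=> xy; congr (_ *: _); apply: eq_bigr. Qed.

Lemma average_cst (v : 'rV[R]_m) : (0 < N)%N -> average (fun _ : 'I_N => v) = v.
Proof.
move=> N0; rewrite /average sumr_const card_ord -(scaler_nat N v) scalerA.
by rewrite mulVf ?scale1r// pnatr_eq0 -lt0n.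
Qed.

(** Bias-variance identity: the cross terms of the expanded squares add up to
    - 2 N |average x|^2. *)
Lemma sum_dot_sub_average x : (0 < N)%N ->
  \sum_i dot (average x - x i) (average x - x i)
  = \sum_i dot (x i) (x i) - N%:R * dot (average x) (average x).
Proof.
move=> N0; have N0' : N%:R != 0 :> R by rewrite pnatr_eq0 -lt0n.
have sx : \sum_i dot (x i) (average x) = N%:R * dot (average x) (average x).
  rewrite -dot_suml -dotZl; congr dot.
  by rewrite /average scalerA divff// scale1r.
move: (average x) sx => y sx.
under eq_bigr => i _.
  rewrite (_ : dot _ _ = dot (x i) (x i) + dot y y - 2 * dot (x i) y).
    over.
  rewrite !dotE (dotC y (x i)); ring.
rewrite sumrB big_split/= -mulr_sumr sx sumr_const card_ord -mulr_natl; ring.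
Qed.

Lemma sum_dot_sub_average_le x : (0 < N)%N ->
  \sum_i dot (average x - x i) (average x - x i) <= \sum_i dot (x i) (x i).
Proof.
by move=> N0; rewrite sum_dot_sub_average// gerBl mulr_ge0// dot_ge0.
Qed.

(** Jensen's inequality for the square, as the nonnegativity of the variance. *)
Lemma dot_average_le x : (0 < N)%N ->
  dot (average x) (average x) <= N%:R^-1 * \sum_i dot (x i) (x i).
Proof.
move=> N0; rewrite ler_pdivlMl ?ltr0n// -subr_ge0 -sum_dot_sub_average//.
by apply: sumr_ge0 => i _; exact: dot_ge0.
Qed.

End Averages.

(** The sum is its number of terms times their mean, to which Jensen's
    inequality applies. *)
Lemma dot_sum_nat_le (R : realType) (m a b : nat) (g : nat -> 'rV[R]_m) :
  dot (\sum_(a <= k < b) g k) (\sum_(a <= k < b) g k)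
  <= (b - a)%:R * \sum_(a <= k < b) dot (g k) (g k).
Proof.
have [|ab] := leqP b a.
  by move=> ba; rewrite !big_geq// mulr0 /dot big1// => j _; rewrite mxE mul0r.
have ab0 : (0 < b - a)%N by rewrite subn_gt0.
rewrite -ler_pdivrMl ?ltr0n//.
have -> : \sum_(a <= k < b) g k =
    (b - a)%:R *: average (fun i : 'I_(b - a) => g (i + a)%N).
  rewrite /average scalerA divff ?scale1r ?pnatr_eq0 -?lt0n//.
  by rewrite -{1}[a]add0n big_addn big_mkord.
set w := average _; rewrite (dotZl _ w) (dotZr _ w).
rewrite mulKf ?pnatr_eq0 -?lt0n// /w -ler_pdivlMl ?ltr0n//.
have -> : \sum_(a <= k < b) dot (g k) (g k) =
    \sum_(i < b - a) dot (g (i + a)%N) (g (i + a)%N).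
  by rewrite -{1}[a]add0n big_addn big_mkord.
exact: dot_average_le.
Qed.

(** * Gradients and the descent inequality *)

Section Gradient.
Context {R : realType} {m : nat}.
Implicit Types (f : 'rV[R]_m -> R) (x v : 'rV[R]_m).

Lemma derive_dot_grad f x v : differentiable f x -> 'D_v f x = dot (grad f x) v.
Proof.
move=> fx; rewrite deriveE// {1}(row_sum_delta v) linear_sum /dot.
by apply: eq_bigr => j _; rewrite linearZ/= mxE deriveE// mulrC.
Qed.

Lemma is_derive_line f x v (s : R) : (forall y, differentiable f y) ->
  is_derive s 1 (fun r : R => f (x + r *: v)) (dot (grad f (x + s *: v)) v).
Proof.
move=> fd; rewrite -derive_dot_grad//.
have e : (fun h : R => h^-1 *: (((fun r : R => f (x + r *: v)) \o shift s) h%:A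
              - f (x + s *: v))) =
         (fun h : R => h^-1 *: ((f \o shift (x + s *: v)) (h *: v)
              - f (x + s *: v))).
  apply/funext => h /=; congr (_ *: (f _ - _)).
  by rewrite [_%:A]mulr1 scalerDl addrCA.
split; last by rewrite /derive e.
by rewrite /derivable e; exact: diff_derivable.
Qed.

(** The mean value theorem for the excess of f over its quadratic model on the
    segment from x to y: the derivative of that excess at s is
    dot (grad f (x + s v) - grad f x) v - L s |v|^2 with v = y - x, which the
    Lipschitz bound makes nonpositive. *)
Lemma descent f (L : R) : 0 < L -> (forall x, differentiable f x) ->
  (forall x y, enorm (grad f x - grad f y) <= L * enorm (x - y)) ->
  forall x y, f y <= f x + dot (grad f x) (y - x)
                     + L / 2 * dot (y - x) (y - x).
Proof.
move=> L0 fd lip x y; set v := y - x.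
pose psi := (fun r : R => f (x + r *: v)) - (dot (grad f x) v) \*: (@id R)
            - (L / 2 * dot v v) \*: ((@id R) ^+ 2).
have scaleM (a b : R) : a *: (b : R) = a * b by [].
have dpsi (s : R) : is_derive s 1 psi
    (dot (grad f (x + s *: v)) v - dot (grad f x) v
     - L / 2 * dot v v * (2 * s)).
  apply: is_derive_eq.
    by apply: is_deriveB; apply: is_deriveB; exact: is_derive_line.
  by rewrite !scaleM !mulr1.
have psi01 : psi 1 - psi 0 = f y - dot (grad f x) v - L / 2 * dot v v - f x.
  rewrite /psi !fctE /= !scaleM scale1r scale0r addr0 expr1n expr0n/=.
  by rewrite !mulr0 !mulr1 !subr0 (addrC x) subrK.
have [|c] := MVT ltr01 (fun s _ => dpsi s).
  by apply: derivable_within_continuous => s _; exact: ex_derive.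
rewrite in_itv/= => /andP[c0 c1]; rewrite psi01 subr0 mulr1 => E.
have : dot (grad f (x + c *: v) - grad f x) v <= L * c * dot v v.
  apply: dot_le_of_enorm; first by rewrite mulr_gt0.
  apply: (le_trans (lip _ _)); rewrite -mulrA ler_pM2l// addrC addKr.
  rewrite /enorm le_eqVlt; apply/orP; left; apply/eqP.
  rewrite -[c in RHS]gtr0_norm// -sqrtr_sqr -sqrtrM ?sqr_ge0//.
  congr Num.sqrt; rewrite mulr_sumr.
  by apply: eq_bigr => j _; rewrite mxE exprMn.
rewrite dotBl => h; lra.
Qed.

End Gradient.

(** * Measurability of functions of a measurable vector *)

Lemma measurable_countable_partition d d' (S : measurableType d)
    (S' : measurableType d') (C : countType) (k : S -> C) (h : C -> S -> S') :
  (forall c, measurable (k @^-1` [set c])) ->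
  (forall c, measurable_fun setT (h c)) ->
  measurable_fun setT (fun s => h (k s) s).
Proof.
move=> mk mh _ B mB; rewrite setTI.
have -> : (fun s => h (k s) s) @^-1` B = \bigcup_(n : nat)
    (if unpickle n is Some c then k @^-1` [set c] `&` h c @^-1` B else set0).
  apply/seteqP; split => [s Bs|s [n _]].
    by exists (pickle (k s)) => //; rewrite pickleK.
  by case: (unpickle n) => [c|//] [/= -> ].
apply: bigcup_measurable => n _; case: (unpickle n) => [c|//].
by apply: measurableI => //; rewrite -[_ @^-1` B]setTI; exact: mh.
Qed.

Lemma measurable_floor_preimage d (S : measurableType d) (R : realType)
    (f : S -> R) (k : int) : measurable_fun setT f ->
  measurable [set s | Num.floor (f s) = k].
Proof.
move=> mf.
have -> : [set s | Num.floor (f s) = k] = f @^-1` `[k%:~R, (k + 1)%:~R[%classic.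
  apply/seteqP; split => s /=; rewrite in_itv/=.
    by move=> <-; exact: floor_itv.
  exact: floor_def.
by rewrite -[_ @^-1` _]setTI; exact: mf.
Qed.

Section Caratheodory.
Context d (S : measurableType d) (R : realType) (m : nat).
Variable X : S -> 'rV[R]_m.
Hypothesis mX : forall j, measurable_fun setT (fun s => X s 0 j).

Let cell (n : nat) (s : S) : 'rV[int]_m :=
  \row_j Num.floor (n.+1%:R * X s 0 j).

Let corner (n : nat) (k : 'rV[int]_m) : 'rV[R]_m :=
  \row_j ((k 0 j)%:~R / n.+1%:R).

Let measurable_cell n k : measurable (cell n @^-1` [set k]).
Proof.
have -> : cell n @^-1` [set k] = \bigcap_(j in [set: 'I_m])
    [set s | Num.floor (n.+1%:R * X s 0 j) = k 0 j].
  apply/seteqP; split => [s /= <- j _ /=|s ks]; first by rewrite mxE.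
  by apply/rowP => j; rewrite mxE; exact: ks.
apply: fin_bigcap_measurable => [|j _]; first exact: finite_finset.
apply: measurable_floor_preimage.
exact: measurable_funM.
Qed.

Let corner_cvg s : corner n (cell n s) @[n --> \oo] --> X s.
Proof.
apply/cvg_ballP => e e0; near=> n; split => // i j; rewrite ord1 !mxE.
have n0 : 0 < n.+1%:R :> R by rewrite ltr0n.
have : n.+1%:R^-1 < e by near: n; exact: (near_infty_natSinv_lt (PosNum e0)).
rewrite /ball/= ltr_norml -[X in X < _]mul1r ltr_pdivrMr// => ne.
have /andP[] := floor_itv (n.+1%:R * X s 0 j).
move: (Num.floor _) => k; rewrite intrD => kx xk.
have -> : X s 0 j - k%:~R / n.+1%:R = (n.+1%:R * X s 0 j - k%:~R) / n.+1%:R.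
  by field; rewrite gt_eqF.
rewrite ltr_pdivlMr// ltr_pdivrMr//; apply/andP; split; lra.
Unshelve. all: by end_near. Qed.

(** A function that is continuous in x and measurable in s is measurable along
    a measurable x = X s: rounding X s down to a grid of mesh 1/(n+1) gives
    countably many cases, and the grid values converge to the exact one. *)
Lemma measurable_caratheodory (g : 'rV[R]_m -> S -> R) :
  (forall s x, {for x, continuous (g ^~ s)}) ->
  (forall x, measurable_fun setT (g x)) ->
  measurable_fun setT (fun s => g (X s) s).
Proof.
move=> cg mg.
apply: (@measurable_fun_cvg _ _ _ _ (fun n s => g (corner n (cell n s)) s)).
  move=> n; exact: (@measurable_countable_partition _ _ _ _ _ (cell n)
    (fun k s => g (corner n k) s)).
move=> s _; apply: (@continuous_cvg _ _ _ _ _ _ (g ^~ s)); first exact: cg.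
exact: corner_cvg.
Qed.

(** A directional derivative is the limit of difference quotients along steps
    1/(n+1), each of which is covered by the Caratheodory criterion. *)
Lemma measurable_grad (g : 'rV[R]_m -> S -> R) (j : 'I_m) :
  (forall s x, differentiable (g ^~ s) x) ->
  (forall x, measurable_fun setT (g x)) ->
  measurable_fun setT (fun s => grad (g ^~ s) (X s) 0 j).
Proof.
move=> dg mg; pose q (n : nat) s :=
  (n.+1%:R^-1)^-1 *: (g (n.+1%:R^-1 *: delta_mx 0 j + X s) s - g (X s) s).
apply: (@measurable_fun_cvg _ _ _ _ q).
  move=> n; apply: measurable_funM => //; apply: measurable_funB; last first.
    apply: measurable_caratheodory => // s x.
    exact: differentiable_continuous.
  apply: (measurable_caratheodory (g := fun x s =>
    g (n.+1%:R^-1 *: delta_mx 0 j + x) s)) => [s x|x]; last exact: mg.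
  apply: differentiable_continuous.
  exact: (@differentiable_comp _ _ _ _
    (fun y : 'rV[R]_m => n.+1%:R^-1 *: delta_mx 0 j + y) (g ^~ s)).
move=> s _; rewrite mxE.
have /cvg_ex[l gl] : derivable (g ^~ s) (X s) (delta_mx 0 j).
  exact: diff_derivable.
have -> : 'D_(delta_mx 0 j) (g ^~ s) (X s) = l by exact: cvg_lim.
apply: ((cvgr_dnbhsP _ _ _).1 gl (fun n => n.+1%:R^-1)); split.
  by move=> n; rewrite invr_eq0 pnatr_eq0.
exact: cvg_harmonic.
Qed.

End Caratheodory.

(** * Freezing an independent variable *)

Section Freezing.
Local Open Scope ereal_scope.
Context d0 d1 d2 (Omega : measurableType d0) (S : measurableType d1)
  (Z : measurableType d2) (R : realType).
Variables (P : probability Omega R) (D : probability Z R).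
Variables (U : {mfun Omega >-> S}) (V : {mfun Omega >-> Z}).
Hypothesis indepUV : forall A B, measurable A -> measurable B ->
  P (U @^-1` A `&` V @^-1` B) = P (U @^-1` A) * D B.

Let UV w := (U w, V w).

Let mUV : measurable_fun setT UV.
Proof. exact: measurable_fun_pair. Qed.

Let joint_law A : measurable A ->
  (distribution P U \x D) A = pushforward P UV A.
Proof.
move=> mA; have := @product_measure_unique _ _ _ _ _ (distribution P U) D
  (pushforward P UV).
by apply => // B C mB mC; exact: indepUV.
Qed.

(** By independence the joint law of (U, V) is the product of the law of U
    and D, so Tonelli integrates over V first. *)
Lemma ge0_integral_freeze (phi : S * Z -> \bar R) :
  measurable_fun setT phi -> (forall x, 0 <= phi x) ->
  \int[P]_w phi (U w, V w) = \int[P]_w \int[D]_z phi (U w, z).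
Proof.
move=> mphi phi0.
transitivity (\int[distribution P U \x D]_x phi x).
  rewrite -[LHS](ge0_integral_pushforward mUV P (D := setT))//.
  by apply: eq_measure_integral => A mA _; exact/esym/joint_law.
rewrite fubini_tonelli1// /fubini_F.
rewrite ge0_integral_pushforward// => [|y _]; last exact: integral_ge0.
exact: measurable_fun_fubini_tonelli_F.
Qed.

Let integrable_joint (phi : S * Z -> \bar R) : measurable_fun setT phi ->
  P.-integrable setT (fun w => phi (U w, V w)) ->
  (distribution P U \x D).-integrable setT phi.
Proof.
move=> mphi /integrableP[_ foo]; apply/integrableP; split => //.
rewrite (eq_measure_integral (pushforward P UV)); last first.
  by move=> A mA _; exact: joint_law.
rewrite (ge0_integral_pushforward mUV)//; exact: measurableT_comp.
Qed.

Lemma integrable_freeze (phi : S * Z -> \bar R) : measurable_fun setT phi ->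
  P.-integrable setT (fun w => phi (U w, V w)) ->
  (distribution P U).-integrable setT (fun s => \int[D]_z phi (s, z)).
Proof.
by move=> mphi iphi; apply: integrable_fubini_F; exact: integrable_joint.
Qed.

Lemma integral_freeze (phi : S * Z -> \bar R) : measurable_fun setT phi ->
  P.-integrable setT (fun w => phi (U w, V w)) ->
  \int[P]_w phi (U w, V w) =
  \int[distribution P U]_s \int[D]_z phi (s, z).
Proof.
move=> mphi iphi; have jphi := integrable_joint mphi iphi.
rewrite (integral12_prod_meas1 jphi).
rewrite -[LHS](integral_pushforward mUV (D := setT))//.
by apply: eq_measure_integral => A mA _; exact/esym/joint_law.
Qed.

End Freezing.

(** * Independence from a generated sigma-algebra *)

Section Independence.
Context (R : realType) (dO : measure_display) (Omega : measurableType dO)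
  (P : probability Omega R) (K : choiceType) (J : set K)
  (d : K -> measure_display) (S : forall k, measurableType (d k))
  (X : forall k, Omega -> S k).
Hypothesis mX : forall k, measurable_fun setT (X k).

Definition generated_by (H : set K) : set (set Omega) :=
  [set A | exists k (B : set (S k)),
     [/\ H k, measurable B & A = X k @^-1` B]].

Lemma generated_by_measurable H : generated_by H `<=` measurable.
Proof.
by move=> _ [k [B [_ mB ->]]]; rewrite -[_ @^-1` _]setTI; exact: mX.
Qed.

Lemma measurable_generated_by (H : set K) k : H k ->
  @measurable_fun _ _ (g_sigma_algebraType (generated_by H)) (S k) setT (X k).
Proof.
move=> Hk _ B mB; rewrite setTI; apply: sub_sigma_algebra.
by exists k, B.
Qed.

(** The events fixing finitely many of the generating variables form a
    pi-system on which the product rule is the independence hypothesis; two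
    finite measures that agree on a pi-system agree on what it generates. *)
Lemma independent_generated_by (r : seq K) (k0 : K) :
  mutually_independent P J X -> uniq (k0 :: r) ->
  (forall k, k \in k0 :: r -> J k) ->
  forall A B, <<s generated_by [set` r] >> A -> measurable B ->
  P (A `&` X k0 @^-1` B) = (P A * P (X k0 @^-1` B))%E.
Proof.
move=> ind ur Jr A B sA mB; have /andP[k0r ur'] := ur.
(* The intersection runs over all of r: a variable that an event leaves free
   is constrained by setT, which makes the family closed under intersection. *)
pose E (F : forall k, set (S k)) := \bigcap_(k in [set` r]) (X k @^-1` F k).
pose Q : set (set Omega) :=
  [set A | exists2 F, (forall k, measurable (F k)) & A = E F].
have mpre k (C : set (S k)) : measurable C -> measurable (X k @^-1` C).
  by move=> mC; rewrite -[_ @^-1` _]setTI; exact: mX.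
have Qm : Q `<=` measurable.
  move=> _ [F mF ->]; apply: fin_bigcap_measurable => [|k _]; last exact: mpre.
  exact: finite_seq.
have QT : Q setT.
  by exists (fun=> setT) => //; apply/seteqP; split.
have QI : setI_closed Q.
  move=> _ _ [F mF ->] [F' mF' ->]; exists (fun k => F k `&` F' k).
    by move=> k; exact: measurableI.
  by rewrite /E -bigcapI.
have GQ : generated_by [set` r] `<=` Q.
  move=> _ [k [C [kr mC ->]]].
  exists (dfwith (fun k => [set: S k]) k C).
    by move=> k'; case: dfwithP.
  apply/seteqP; split => [w XC k' k'r /=|w /(_ k kr)/=]; last first.
    by rewrite dfwithin.
  by case: dfwithP.
have mXB := mpre _ _ mB.
have p0 : (0 <= fine (P (X k0 @^-1` B)))%R by exact: fine_ge0.
have -> : (P A * P (X k0 @^-1` B))%E = mscale (NngNum p0) P A.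
  by rewrite /mscale/= fineK ?fin_num_measure// muleC.
rewrite -[LHS]/(mrestr P mXB A).
apply: (g_sigma_algebra_measure_unique Q Qm (fun=> setT)) => //.
- by rewrite bigcup_const//; exists 0%N.
- move=> _ [F mF ->]; rewrite /= /mrestr /mscale/= fineK ?fin_num_measure//.
  pose F' := dfwith F k0 B.
  have mF' k : measurable (F' k) by rewrite /F'; case: dfwithP.
  have EF' : E F = \bigcap_(k in [set` r]) (X k @^-1` F' k).
    apply: eq_bigcapr => k kr; rewrite /F' dfwithout//.
    by apply: contraNneq k0r => ->.
  have rk0 : [set` k0 :: r] = k0 |` [set` r].
    by apply/predeqP => k /=; rewrite inE; split => /predU1P.
  have := ind _ ur Jr _ mF'.
  rewrite big_cons rk0 bigcap_setU1 -EF' {1 2}/F' dfwithin setIC => ->.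
  congr (_ * _)%E; rewrite EF'; apply/esym; apply: ind => //.
  by move=> k kr; apply: Jr; rewrite inE kr orbT.
- move=> n; rewrite /= /mrestr setTI.
  by rewrite -ge0_fin_numE// fin_num_measure.
- by apply: sub_smallest2r sA.
Qed.

End Independence.

(** * One iteration along a realization *)

Section OneStep.
Context {R : realType} {N m : nat} (N0 : (0 < N)%N).
Variables (fl : 'I_N -> 'rV[R]_m -> R).
Hypothesis fd : forall i x, differentiable (fl i) x.

Lemma grad_mean x :
  grad (fun u => N%:R^-1 * \sum_(i < N) fl i u) x
  = average (fun i => grad (fl i) x).
Proof.
apply/rowP => j; rewrite mxE /average mxE summxE.
have -> : (fun u => N%:R^-1 * \sum_(i < N) fl i u) =
    N%:R^-1 \*: (\sum_(i < N) fl i).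
  by apply/funext => u /=; rewrite fct_sumE.
rewrite deriveZ; last by apply: derivable_sum => i; exact: diff_derivable.
rewrite derive_sum; last by move=> i; exact: diff_derivable.
by congr (_ * _); apply: eq_bigr => i _; rewrite mxE.
Qed.

Variables (L : R) (L0 : 0 < L).
Hypothesis lip : forall i x y,
  enorm (grad (fl i) x - grad (fl i) y) <= L * enorm (x - y).

Lemma dot_grad_sub_le i x y :
  dot (grad (fl i) x - grad (fl i) y) (grad (fl i) x - grad (fl i) y)
  <= L ^+ 2 * dot (x - y) (x - y).
Proof.
rewrite -!sqr_enorm -exprMn ler_sqr ?nnegrE ?mulr_ge0 ?sqrtr_ge0//.
exact: ltW.
Qed.

Let f u : R := N%:R^-1 * \sum_(i < N) fl i u.

Lemma descent_mean x y :
  f y <= f x + dot (average (fun i => grad (fl i) x)) (y - x)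
         + L / 2 * dot (y - x) (y - x).
Proof.
have N0' : 0 < N%:R :> R by rewrite ltr0n.
rewrite /f ler_pdivrMl// !mulrDr mulVKf ?gt_eqF// /average dotZl.
rewrite mulVKf ?gt_eqF// dot_suml.
have -> : N%:R * (L / 2 * dot (y - x) (y - x)) =
    \sum_(i < N) L / 2 * dot (y - x) (y - x).
  by rewrite sumr_const card_ord mulr_natl.
by rewrite -!big_split/=; apply: ler_sum => i _; exact: descent.
Qed.

(** With A the gradient at the mean iterate, B the mean of the local gradients
    and E the mean noise, smoothness bounds the decrease of f through
    - gamma A.(B + E) + (L gamma^2 / 2) |B + E|^2. Polarization turns - A.B
    into (|A - B|^2 - |A|^2 - |B|^2) / 2, the step size bound L gamma <= 1 lets
    - |B|^2 absorb the quadratic term in B, and the Lipschitz bound controls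
    |A - B|^2 by the spread of the iterates. *)
Lemma one_step (gamma : R) (x g : 'I_N -> 'rV[R]_m) (xb A B E : 'rV[R]_m) :
  0 < gamma -> gamma <= L^-1 -> xb = average x ->
  A = average (fun i => grad (fl i) xb) ->
  B = average (fun i => grad (fl i) (x i)) ->
  E = average (fun i => g i - grad (fl i) (x i)) ->
  gamma / 2 * dot A A <=
    f xb - f (xb - gamma *: average g)
    + gamma * L ^+ 2 / 2 * (N%:R^-1 * \sum_i dot (xb - x i) (xb - x i))
    + dot (L * gamma ^+ 2 *: B - gamma *: A) E
    + L * gamma ^+ 2 / 2 * dot E E.
Proof.
move=> gamma0 gammaL xbE AE' BE' EE'.
have gE : average g = B + E.
  by rewrite BE' EE' -averageD; apply: eq_average => i; rewrite addrC subrK.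
have Lgamma : L * gamma <= 1 by rewrite -ler_pdivlMl// mulr1.
have spread : dot (A - B) (A - B) <=
    L ^+ 2 * (N%:R^-1 * \sum_i dot (xb - x i) (xb - x i)).
  rewrite AE' BE' -averageB; apply: (le_trans (dot_average_le _ N0)).
  rewrite mulrCA ler_pM2l ?invr_gt0 ?ltr0n// mulr_sumr.
  by apply: ler_sum => i _; exact: dot_grad_sub_le.
have := descent_mean xb (xb - gamma *: average g).
rewrite -AE' gE (addrC xb) addrK.
move: (f _) (f _) => f' f0.
move: spread; move: (N%:R^-1 * _) => W.
have := dot_ge0 B.
rewrite !dotE (dotC B A) (dotC E B).
move: (dot A A) (dot A B) (dot B B) (dot A E) (dot B E) (dot E E).
move=> AA AB BB AE BE EE BB0 spread step.
(* The two products that the linear combination needs: gamma times the spread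
   bound, and the slack 1 - L gamma times gamma |B|^2. *)
have : 0 <= gamma * (L ^+ 2 * W - (AA - AB - (AB - BB))).
  by rewrite mulr_ge0 ?subr_ge0 ?(ltW gamma0)//; lra.
have : 0 <= (1 - L * gamma) * (gamma * BB).
  by rewrite mulr_ge0 ?subr_ge0// mulr_ge0// ltW.
lra.
Qed.

End OneStep.

(** * Spread of the iterates between two averagings *)

Section Iterates.
Context {R : realType} {N m : nat} (Z : 'I_N -> Type)
  (F : forall i, 'rV[R]_m -> Z i -> R) (gamma : R) (I : nat) (y : 'rV[R]_m)
  (z : forall i : 'I_N, nat -> Z i).
Hypotheses (N0 : (0 < N)%N) (I0 : (0 < I)%N).

Let x := prsgd (@F) gamma I y z.

Definition sample_grad (t : nat) (i : 'I_N) : 'rV[R]_m :=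
  grad (fun u => @F i u (z i t)) (x t.-1 i).

(** At a multiple of I the averaging precedes the gradient step, so the
    gradient of that very iteration already separates the workers. Before the
    first averaging the common point is the initial one and the window starts
    at iteration 1. *)
Definition last_sync (t : nat) : nat := maxn 1 (t %/ I * I).

Lemma average_prsgdS t :
  average (x t.+1) = average (x t) - gamma *: average (sample_grad t.+1).
Proof.
rewrite -averageZ /x /=; case: (boolP (I %| t.+1)%N) => _.
  by rewrite averageB (average_cst (average (x t)) N0).
by rewrite averageB.
Qed.

Lemma last_sync_leS t : (last_sync t <= t.+1)%N.
Proof. by rewrite geq_max ltnS/= (leq_trans (leq_trunc_div t I)). Qed.

Lemma leq_sub_last_sync t : (t.+1 - last_sync t <= I)%N.
Proof.
rewrite leq_subLR (leq_trans (ltn_ceil t I0))// mulSn addnC leq_add2r.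
exact: leq_maxr.
Qed.

Lemma prsgd_since_sync t : exists b, forall i,
  x t i = b - gamma *: \sum_(last_sync t <= s < t.+1) sample_grad s i.
Proof.
elim: t => [|t [b IH]].
  by exists y => i; rewrite /last_sync div0n mul0n big_geq// scaler0 subr0.
rewrite {1}/x /=; case: (boolP (I %| t.+1)%N) => It.
  exists (average (x t)) => i.
  by rewrite /last_sync divnK// (maxn_idPr _)// big_nat1.
exists b => i.
have -> : last_sync t.+1 = last_sync t.
  by rewrite /last_sync divnS// (negbTE It).
rewrite big_nat_recr ?last_sync_leS//= scalerDr opprD addrA -/x.
by rewrite -IH.
Qed.

(** Since the last averaging all workers have left a common point with at most
    I gradient steps each, so their spread around the mean is at most the sum
    of the squared lengths of these displacements. *)
Lemma prsgd_spread t :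
  \sum_i dot (average (x t) - x t i) (average (x t) - x t i) <=
  gamma ^+ 2 * I%:R *
    \sum_i \sum_(last_sync t <= s < t.+1)
      dot (sample_grad s i) (sample_grad s i).
Proof.
have [b xE] := prsgd_since_sync t.
pose S i := \sum_(last_sync t <= s < t.+1) sample_grad s i.
have dE i : average (x t) - x t i = - gamma *: (average S - S i).
  rewrite (eq_average xE) averageB (average_cst b N0) averageZ xE -/(S i).
  by rewrite scaleNr scalerBr !opprB addrC addrA subrK.
under eq_bigr => i _ do rewrite dE dotZl dotZr mulrA mulrNN -expr2.
rewrite -mulr_sumr -mulrA ler_wpM2l ?sqr_ge0//.
apply: (le_trans (sum_dot_sub_average_le S N0)).
rewrite mulr_sumr; apply: ler_sum => i _.
apply: (le_trans (dot_sum_nat_le _ _ _)).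
rewrite ler_wpM2r ?ler_nat ?leq_sub_last_sync//.
by apply: sumr_ge0 => s _; exact: dot_ge0.
Qed.

End Iterates.

(** * Integrable and square-integrable random variables *)

Lemma measurable_dot (R : realType) d (S : measurableType d) m
    (V W : S -> 'rV[R]_m) :
  (forall j, measurable_fun setT (fun s => V s 0 j)) ->
  (forall j, measurable_fun setT (fun s => W s 0 j)) ->
  measurable_fun setT (fun s => dot (V s) (W s)).
Proof.
by move=> mV mW; apply: measurable_sum => j; exact: measurable_funM.
Qed.

Section SquareIntegrable.
Context {R : realType} {d : measure_display} {Omega : measurableType d}
  (P : probability Omega R).
Implicit Types X Y : Omega -> R.

Definition integrable_fun X : Prop := P.-integrable setT (EFin \o X).

Definition sq_integrable X : Prop :=
  measurable_fun setT X /\ integrable_fun (fun w => X w ^+ 2).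

Lemma integrable_fun_measurable X : integrable_fun X -> measurable_fun setT X.
Proof. by move=> /integrableP[/measurable_EFinP]. Qed.

Lemma integrable_fun_le X Y : measurable_fun setT X ->
  (forall w, `|X w| <= Y w) -> integrable_fun Y -> integrable_fun X.
Proof.
move=> mX XY iY; apply: le_integrable iY => //; first exact/measurable_EFinP.
by move=> w _ /=; rewrite lee_fin (le_trans (XY w))// ler_norm.
Qed.

Lemma integrable_fun_cst c : integrable_fun (fun=> c).
Proof. exact: (finite_measure_integrable_cst P). Qed.

Lemma integral_probability_cst c : (\int[P]_w c%:E = c%:E)%E.
Proof.
by rewrite integral_cst// (_ : _ setT = 1%E) ?mule1//; exact: probability_setT.
Qed.

Lemma Rintegral_probability_cst c : \int[P]_w c = c.
Proof. by rewrite /Rintegral integral_probability_cst. Qed.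

Lemma integrable_funD X Y : integrable_fun X -> integrable_fun Y ->
  integrable_fun (fun w => X w + Y w).
Proof. exact: integrableD. Qed.

Lemma integral_sub_eq0 X Y A : measurable A ->
  integrable_fun X -> integrable_fun Y ->
  (\int[P]_(w in A) (X w)%:E = \int[P]_(w in A) (Y w)%:E)%E ->
  (\int[P]_(w in A) (X w - Y w)%:E = 0)%E.
Proof.
move=> mA iX iY XY.
have iXA : P.-integrable A (EFin \o X) by exact: integrableS iX.
have iYA : P.-integrable A (EFin \o Y) by exact: integrableS iY.
by rewrite integralB_EFin// XY subee// integrable_fin_num.
Qed.

Lemma integrable_funZ c X :
  integrable_fun X -> integrable_fun (fun w => c * X w).
Proof. exact: integrableZl. Qed.

Lemma integrable_fun_sum (J : eqType) (s : seq J) (X : J -> Omega -> R) :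
  {in s, forall j, integrable_fun (X j)} ->
  integrable_fun (fun w => \sum_(j <- s) X j w).
Proof.
elim: s => [_|j s IH iX].
  under [X in integrable_fun X]eq_fun do rewrite big_nil.
  exact: integrable_fun_cst.
under [X in integrable_fun X]eq_fun do rewrite big_cons.
apply: integrable_funD; first by apply: iX; exact: mem_head.
by apply: IH => k ks; apply: iX; rewrite inE ks orbT.
Qed.

Lemma Rintegral_sum (J : eqType) (s : seq J) (X : J -> Omega -> R) :
  {in s, forall j, integrable_fun (X j)} ->
  \int[P]_w (\sum_(j <- s) X j w) = \sum_(j <- s) \int[P]_w X j w.
Proof.
elim: s => [_|j s IH iX].
  rewrite big_nil; under eq_Rintegral do rewrite big_nil.
  by rewrite Rintegral_cst// mul0r.
have iXs : {in s, forall k, integrable_fun (X k)}.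
  by move=> k ks; apply: iX; rewrite inE ks orbT.
under eq_Rintegral do rewrite big_cons.
rewrite RintegralD ?IH ?big_cons//; first by apply: iX; exact: mem_head.
exact: integrable_fun_sum.
Qed.

(** |X Y| <= X^2 + Y^2. *)
Lemma sq_integrable_mul X Y : sq_integrable X -> sq_integrable Y ->
  integrable_fun (fun w => X w * Y w).
Proof.
move=> [mX iX] [mY iY].
apply: (integrable_fun_le (Y := fun w => X w ^+ 2 + Y w ^+ 2)).
- exact: measurable_funM.
- move=> w; rewrite ler_norml; have := sqr_ge0 (X w + Y w).
  have := sqr_ge0 (X w - Y w); have := sqr_ge0 (X w); have := sqr_ge0 (Y w).
  by move=> *; apply/andP; split; lra.
- exact: integrable_funD.
Qed.

Lemma sq_integrable_integrable X : sq_integrable X -> integrable_fun X.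
Proof.
move=> iX; have : sq_integrable (fun=> 1).
  by split; [exact: measurable_cst|exact: integrable_fun_cst].
move=> /(sq_integrable_mul iX).
by under [X in integrable_fun X]eq_fun do rewrite mulr1.
Qed.

Lemma sq_integrableD X Y : sq_integrable X -> sq_integrable Y ->
  sq_integrable (fun w => X w + Y w).
Proof.
move=> iX iY; split; first by apply: measurable_funD; [exact: iX.1|exact: iY.1].
under [X in integrable_fun X]eq_fun do rewrite sqrrD.
apply: integrable_funD; last exact: iY.2.
apply: integrable_funD; first exact: iX.2.
under [X in integrable_fun X]eq_fun do rewrite -mulr_natl.
by apply: integrable_funZ; exact: sq_integrable_mul.
Qed.

Lemma sq_integrableZ c X : sq_integrable X -> sq_integrable (fun w => c * X w).
Proof.
move=> [mX iX]; split; first exact: measurable_funM.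
under [X in integrable_fun X]eq_fun do rewrite exprMn.
exact: integrable_funZ.
Qed.

Lemma sq_integrableB X Y : sq_integrable X -> sq_integrable Y ->
  sq_integrable (fun w => X w - Y w).
Proof.
move=> iX iY; under [X in sq_integrable X]eq_fun do rewrite -mulN1r.
by apply: sq_integrableD => //; exact: sq_integrableZ.
Qed.

Lemma sq_integrable_sum J (s : seq J) (X : J -> Omega -> R) :
  (forall j, sq_integrable (X j)) ->
  sq_integrable (fun w => \sum_(j <- s) X j w).
Proof.
move=> iX; elim: s => [|j s IH].
  under [X in sq_integrable X]eq_fun do rewrite big_nil.
  by split; [exact: measurable_cst|exact: integrable_fun_cst].
under [X in sq_integrable X]eq_fun do rewrite big_cons.
exact: sq_integrableD.
Qed.

Lemma sq_integrable_bounded X c : measurable_fun setT X ->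
  (forall w, X w ^+ 2 <= c) -> sq_integrable X.
Proof.
move=> mX Xc; split => //; apply: integrable_fun_le (integrable_fun_cst c).
  exact: measurable_funX.
by move=> w; rewrite ger0_norm ?sqr_ge0.
Qed.

Lemma integrable_dot m (V W : Omega -> 'rV[R]_m) :
  (forall k, sq_integrable (fun w => V w 0 k)) ->
  (forall k, sq_integrable (fun w => W w 0 k)) ->
  integrable_fun (fun w => dot (V w) (W w)).
Proof.
by move=> iV iW; apply: integrable_fun_sum => k _; exact: sq_integrable_mul.
Qed.

Lemma sq_integrable_of_dot m (V : Omega -> 'rV[R]_m) (c : R) :
  (forall k, measurable_fun setT (fun w => V w 0 k)) ->
  (\int[P]_w (dot (V w) (V w))%:E <= c%:E)%E ->
  forall k, sq_integrable (fun w => V w 0 k).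
Proof.
move=> mV Vc k; split => //; apply/integrableP; split.
  by apply/measurable_EFinP; exact: measurable_funX.
apply: (@le_lt_trans _ _ c%:E); last exact: ltry.
apply: le_trans Vc; apply: ge0_le_integral => //.
- apply: measurableT_comp => //.
  by apply/measurable_EFinP; exact: measurable_funX.
- by apply/measurable_EFinP; exact: measurable_dot.
- by move=> w _; rewrite lee_fin ger0_norm ?sqr_ge0// sqr_entry_le_dot.
Qed.

Lemma Rintegral_dot_le m (V : Omega -> 'rV[R]_m) (c : R) :
  (\int[P]_w (dot (V w) (V w))%:E <= c%:E)%E ->
  \int[P]_w dot (V w) (V w) <= c.
Proof.
move=> Vc; rewrite -lee_fin /Rintegral fineK// ge0_fin_numE.
  exact: (le_lt_trans Vc (ltry _)).
by apply: integral_ge0 => w _; rewrite lee_fin dot_ge0.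
Qed.

End SquareIntegrable.

(** * Variables whose frozen mean vanishes *)

Section FreezingNoise.
Context d0 d1 d2 (Omega : measurableType d0) (S : measurableType d1)
  (Z : measurableType d2) (R : realType).
Variables (P : probability Omega R) (D : probability Z R).
Variables (U : {mfun Omega >-> S}) (V : {mfun Omega >-> Z}).
Hypothesis indepUV : forall A B, measurable A -> measurable B ->
  (P (U @^-1` A `&` V @^-1` B) = P (U @^-1` A) * D B)%E.
Variable phi : S * Z -> R.
Hypothesis mphi : measurable_fun setT phi.

(** The mean of phi(s, V) as a function of the frozen value s is a version of
    the conditional expectation of phi(U, V) given U, so it vanishes almost
    surely as soon as phi(U, V) integrates to zero over every event of U. *)
Lemma frozen_mean_eq0 : integrable_fun P (fun w => phi (U w, V w)) ->
  (forall A, measurable A ->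
     \int[P]_(w in U @^-1` A) (phi (U w, V w))%:E = 0)%E ->
  {ae distribution P U, forall s, \int[D]_z (phi (s, z))%:E = 0}%E.
Proof.
move=> iphi phi0.
have mEphi : measurable_fun setT (EFin \o phi) by exact/measurable_EFinP.
have int_eta := integrable_freeze indepUV mEphi iphi.
have : ae_eq (distribution P U) setT
    (fun s => \int[D]_z (phi (s, z))%:E)%E (cst 0%E).
  apply: integral_ae_eq => // A _ mA; rewrite integral0 integral_mkcond.
  have mind : measurable_fun setT (fun p : S * Z => (\1_A p.1 * phi p)%:E).
    apply/measurable_EFinP; apply: measurable_funM => //.
    by apply: measurableT_comp => //; exact: measurable_indic.
  transitivity (\int[distribution P U]_s \int[D]_z (\1_A s * phi (s, z))%:E)%E.
    apply: eq_integral => s _; rewrite patchE indicE; case: ifPn => sA.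
      by under [RHS]eq_integral do rewrite mul1r.
    by rewrite integral0_eq// => z _; rewrite mul0r.
  rewrite -(integral_freeze indepUV mind) /=; last first.
    apply: (le_integrable _ _ _ iphi) => //.
      apply/measurable_EFinP; apply: measurable_funM.
        by apply: measurableT_comp => //; exact: measurable_indic.
      exact: integrable_fun_measurable iphi.
    move=> w _ /=; rewrite lee_fin indicE normrM.
    by case: (_ \in _); rewrite ?normr1 ?mul1r// normr0 mul0r.
  rewrite -[RHS](phi0 _ mA) [RHS]integral_mkcond.
  apply: eq_integral => w _; rewrite patchE indicE -[w \in _]/(U w \in A).
  by case: ifPn => _; rewrite ?mul1r ?mul0r.
by apply: filterS => s /= /(_ Logic.I).
Qed.

(** Freezing U under the expectation leaves psi(U) times the mean that
    vanishes. *)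
Lemma frozen_mean_orthogonal (psi : S -> R) : measurable_fun setT psi ->
  (forall s, D.-integrable setT (fun z => (phi (s, z))%:E)) ->
  {ae distribution P U, forall s, \int[D]_z (phi (s, z))%:E = 0}%E ->
  integrable_fun P (fun w => psi (U w) * phi (U w, V w)) ->
  \int[P]_w (psi (U w) * phi (U w, V w)) = 0.
Proof.
move=> mpsi iphi phi0 ipp.
have mpp : measurable_fun setT (fun p : S * Z => (psi p.1 * phi p)%:E).
  apply/measurable_EFinP; apply: measurable_funM => //.
  exact: measurableT_comp.
have ieta := integrable_freeze indepUV mpp ipp.
rewrite /Rintegral (integral_freeze indepUV mpp ipp).
rewrite (ae_eq_integral (cst 0%E))//; first by rewrite integral0.
  exact: measurable_int ieta.
apply: filterS phi0 => s phis _ /=.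
under eq_integral do rewrite EFinM.
by rewrite integralZl// phis mule0.
Qed.

End FreezingNoise.

(** * The history of the samples as a random variable *)

Section SubSigmaAlgebra.
Context d (Omega : measurableType d) (G : set (set Omega)).
Hypothesis Gm : G `<=` measurable.

(** The identity, as a random variable with values in Omega with a smaller
    sigma-algebra. Freezing it freezes everything that this sigma-algebra
    knows, without choosing a state space for the iterates. *)
Definition sub_sigma_id : Omega -> g_sigma_algebraType G := id.

Let measurable_sub_sigma_id : measurable_fun setT sub_sigma_id.
Proof.
move=> _ A sA; rewrite setTI; move: A sA.
exact: smallest_sub (@sigma_algebra_measurable _ Omega) Gm.
Qed.

HB.instance Definition _ :=
  isMeasurableFun.Build _ _ _ _ sub_sigma_id measurable_sub_sigma_id.

Definition sub_sigma_mfun : {mfun Omega >-> g_sigma_algebraType G} :=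
  sub_sigma_id.

End SubSigmaAlgebra.

(** * Measurability of the iterates *)

Section Problem.
Context (R : realType) (N m : nat) (hN : (1 <= N)%N)
  (d : 'I_N -> measure_display) (Z : forall i : 'I_N, measurableType (d i))
  (D : forall i : 'I_N, probability (Z i) R)
  (F : forall i : 'I_N, 'rV[R]_m -> Z i -> R).
Arguments F : clear implicits.
Hypotheses
  (hFint : forall (i : 'I_N) (x : 'rV[R]_m),
     (D i).-integrable setT (fun z => (F i x z)%:E))
  (hFdiff : forall (i : 'I_N) (z : Z i) (x : 'rV[R]_m),
     differentiable (fun u => F i u z) x)
  (hfdiff : forall (i : 'I_N) (x : 'rV[R]_m),
     differentiable (local_loss D F i) x).

Let df i := grad (local_loss D F i).

Lemma measurable_sample_loss i x : measurable_fun setT (F i x).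
Proof. exact: integrable_fun_measurable (hFint i x). Qed.

Section Measurability.
Context dS (S : measurableType dS).

Lemma measurable_average (X : S -> 'I_N -> 'rV[R]_m) :
  (forall i j, measurable_fun setT (fun s => X s i 0 j)) ->
  forall j, measurable_fun setT (fun s => average (X s) 0 j).
Proof.
move=> mX j; rewrite /average.
under eq_fun do rewrite mxE summxE.
by apply: measurable_funM => //; exact: measurable_sum.
Qed.

Variable X : S -> 'rV[R]_m.
Hypothesis mX : forall j, measurable_fun setT (fun s => X s 0 j).

Lemma measurable_local_grad i j : measurable_fun setT (fun s => df i (X s) 0 j).
Proof.
exact: (measurable_grad mX (g := fun u _ => local_loss D F i u)).
Qed.

Lemma measurable_grad_sample i j (V : S -> Z i) :
  measurable_fun setT V ->
  measurable_fun setT (fun s => grad (fun u => F i u (V s)) (X s) 0 j).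
Proof.
move=> mV; apply: (measurable_grad mX (g := fun u s => F i u (V s))) => //.
by move=> x; apply: measurableT_comp => //; exact: measurable_sample_loss.
Qed.

End Measurability.

(** The iterates are built from the samples by averages and gradients, so they
    are measurable for any sigma-algebra that makes the samples used so far
    measurable. *)
Lemma measurable_prsgd gamma I y0 dS (S : measurableType dS)
    (z : forall i : 'I_N, nat -> S -> Z i) t :
  (forall i s, (1 <= s <= t)%N -> measurable_fun setT (z i s)) ->
  forall i j, measurable_fun setT
    (fun w => prsgd F gamma I y0 (fun k s => z k s w) t i 0 j).
Proof.
elim: t => [|t IH] mz i j; first exact: measurable_cst.
have {}IH k l : measurable_fun setT
    (fun w => prsgd F gamma I y0 (fun k s => z k s w) t k 0 l).
  by apply: IH => k' s /andP[s1 st]; apply: mz; rewrite s1 leqW.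
under eq_fun => w do rewrite /= subr_entry scaler_entry.
apply: measurable_funB.
  by case: (boolP (I %| t.+1)%N) => _ //; exact: measurable_average.
apply: measurable_funM => //.
apply: (measurable_grad_sample (IH i)).
by apply: mz; rewrite leqnn.
Qed.

(** * Moments of the gradients at a fixed point *)

Section Noise.
Variables (sigma G : R).
Hypotheses
  (hvar : forall (i : 'I_N) (x : 'rV[R]_m),
     ('E_(D i)[fun z => (enorm (grad (fun u => F i u z) x
                                 - grad (local_loss D F i) x) ^+ 2)%R]
       <= (sigma ^+ 2)%:E)%E)
  (hmom : forall (i : 'I_N) (x : 'rV[R]_m),
     ('E_(D i)[fun z => (enorm (grad (fun u => F i u z) x) ^+ 2)%R]
       <= (G ^+ 2)%:E)%E).

Let noise i x z := grad (fun u => F i u z) x - df i x.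
Arguments noise : clear implicits.

Let measurable_grad_at i x j :
  measurable_fun setT (fun z => grad (fun u => F i u z) x 0 j).
Proof.
apply: (@measurable_grad _ _ _ _ (fun=> x) _ (fun u z => F i u z)) => //.
by move=> u; exact: measurable_sample_loss.
Qed.

Let measurable_noise_at i x j : measurable_fun setT (fun z => noise i x z 0 j).
Proof.
under eq_fun do rewrite subr_entry.
exact: measurable_funB.
Qed.

Let second_moment_noise i x :
  (\int[D i]_z (dot (noise i x z) (noise i x z))%:E <= (sigma ^+ 2)%:E)%E.
Proof.
by have := hvar i x; rewrite unlock; under eq_integral do rewrite sqr_enorm.
Qed.

Let second_moment_grad i x :
  (\int[D i]_z (dot (grad (fun u => F i u z) x)
                    (grad (fun u => F i u z) x))%:E <= (G ^+ 2)%:E)%E.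
Proof.
by have := hmom i x; rewrite unlock; under eq_integral do rewrite sqr_enorm.
Qed.

(** The local gradient is the difference of the sample gradient and the noise,
    whose second moments are bounded uniformly in x. *)
Lemma local_grad_bound i x :
  dot (df i x) (df i x) <= 2 * sigma ^+ 2 + 2 * G ^+ 2.
Proof.
have nN := second_moment_noise i x.
have nG := second_moment_grad i x.
have iN : integrable_fun (D i) (fun z => dot (noise i x z) (noise i x z)).
  by apply: integrable_dot; exact: sq_integrable_of_dot nN.
have iG : integrable_fun (D i)
    (fun z => dot (grad (fun u => F i u z) x) (grad (fun u => F i u z) x)).
  by apply: integrable_dot; exact: sq_integrable_of_dot nG.
rewrite -[leLHS](Rintegral_probability_cst (D i)).
apply: (@le_trans _ _ (\int[D i]_z (2 * dot (noise i x z) (noise i x z)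
    + 2 * dot (grad (fun u => F i u z) x) (grad (fun u => F i u z) x)))).
  apply: le_Rintegral => //.
  - exact: integrable_fun_cst.
  - by apply: integrable_funD; exact: integrable_funZ.
  - move=> z _; rewrite (_ : dot (noise i x z) (noise i x z) =
      dot (df i x - grad (fun u => F i u z) x)
          (df i x - grad (fun u => F i u z) x)).
      exact: dot_sub_le.
    by rewrite -opprB dotNl dotNr opprK.
rewrite RintegralD//; [|exact: integrable_funZ|exact: integrable_funZ].
rewrite !RintegralZl//.
apply: lerD; rewrite ler_pM2l//; exact: Rintegral_dot_le.
Qed.

Lemma integrable_noise i x j :
  (D i).-integrable setT (fun z => (noise i x z 0 j)%:E).
Proof.
apply: (@sq_integrable_integrable _ _ _ (D i) (fun z => noise i x z 0 j)).
exact: sq_integrable_of_dot (second_moment_noise i x) _.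
Qed.


(** * Noise along the iterates *)

Variables (gamma : R) (I : nat) (y0 : 'rV[R]_m) (T : nat).
Context (dO : measure_display) (Omega : measurableType dO)
  (P : probability Omega R) (zeta : forall i : 'I_N, nat -> {RV P >-> Z i}).
Hypotheses
  (hlaw : forall (i : 'I_N) (t : nat), (1 <= t <= T)%N ->
     forall B : set (Z i), measurable B -> distribution P (zeta i t) B = D i B)
  (hindep : mutually_independent P
     [set k : 'I_N * nat | (1 <= k.2 <= T)%N]
     (fun k : 'I_N * nat => zeta k.1 k.2 : Omega -> Z k.1))
  (hunbiased : forall (i : 'I_N) (t : nat) (j : 'I_m), (1 <= t <= T)%N ->
     let x := fun w => prsgd F gamma I y0 (fun k s => zeta k s w) t.-1 i in
     is_cond_expectation P (past_sigma (fun k s => zeta k s : Omega -> Z k) t)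
       (fun w => grad (fun u => F i u (zeta i t w)) (x w) 0 j)
       (fun w => grad (local_loss D F i) (x w) 0 j)).

Let X (k : 'I_N * nat) : Omega -> Z k.1 := zeta k.1 k.2.
Let x t (w : Omega) := prsgd F gamma I y0 (fun k s => zeta k s w) t.
Let g t (i : 'I_N) (w : Omega) :=
  grad (fun u => F i u (zeta i t w)) (x t.-1 w i).
Let e t (i : 'I_N) (w : Omega) := g t i w - df i (x t.-1 w i).

Let mX k : measurable_fun setT (X k).
Proof. exact: measurable_funPT. Qed.

(** Everything sampled up to iteration t except the sample of worker i at t.
    The samples of the other workers at t are kept, since the noise of worker i
    is multiplied by the noise of another worker in the cross terms. *)
Definition history (t : nat) (i : 'I_N) : seq ('I_N * nat) :=
  [seq k <- [seq (j, s) | j <- enum 'I_N, s <- iota 1 t] | k != (i, t)].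

Lemma mem_history t i (k : 'I_N * nat) :
  (k \in history t i) = (k != (i, t)) && (1 <= k.2 <= t)%N.
Proof.
case: k => j s; rewrite mem_filter; congr (_ && _).
apply/allpairsP/idP => [[[j' s'] /= [_ + [_ ->]]]|st].
  by rewrite mem_iota add1n ltnS.
by exists (j, s); rewrite mem_enum mem_iota add1n ltnS.
Qed.

Let past t := generated_by X [set k : 'I_N * nat | (1 <= k.2 < t)%N].
Let hist t i := generated_by X [set` history t i].

Let past_sigmaE t :
  past_sigma (fun k s => zeta k s : Omega -> Z k) t = <<s past t >>.
Proof.
rewrite /past_sigma; congr (<<s _ >>); apply/predeqP => A; split.
  by move=> [j [s [B [st mB ->]]]]; exists (j, s), B.
by move=> [[j s] [B [st mB ->]]]; exists j, s, B.
Qed.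

Let past_hist t i : past t `<=` hist t i.
Proof.
move=> A [[j s] [B [/andP[s1 st] mB ->]]]; exists (j, s), B; split => //=.
rewrite mem_history /= s1 (ltnW st) !andbT.
by apply/negP => /eqP[_ ts]; move: st; rewrite /= ts ltnn.
Qed.

Let past_measurable t : past t `<=` measurable.
Proof. exact: generated_by_measurable. Qed.

Let hist_measurable t i : hist t i `<=` measurable.
Proof. exact: generated_by_measurable. Qed.

Lemma independent_hist t i A B : (1 <= t <= T)%N ->
  <<s hist t i >> A -> measurable B ->
  P (A `&` zeta i t @^-1` B) = (P A * D i B)%E.
Proof.
move=> tT sA mB; rewrite -(hlaw tT mB).
apply: (independent_generated_by mX hindep (r := history t i)
  (k0 := (i, t))) => //.
  rewrite /= mem_history eqxx/= filter_uniq//.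
  rewrite allpairs_uniq ?enum_uniq ?iota_uniq//.
  by case=> ? ? [].
move=> k; rewrite inE => /predU1P[->//|].
rewrite mem_history => /andP[_ /andP[k1 kt]] /=.
by rewrite k1 (leq_trans kt)//; case/andP: tT.
Qed.

Let measurable_x_past t i j : (0 < t)%N ->
  @measurable_fun _ _ (g_sigma_algebraType (past t)) _ setT
    (fun w => x t.-1 w i 0 j).
Proof.
move=> t0; apply: (@measurable_prsgd _ _ _ _ (g_sigma_algebraType (past t))
  (fun k s => zeta k s : g_sigma_algebraType (past t) -> Z k)).
move=> k s /andP[s1 st].
apply: (measurable_generated_by (X := X) (k := (k, s))).
by rewrite /= s1 -(prednK t0) ltnS.
Qed.

Let measurable_hist t i dS (S : measurableType dS) (Y : Omega -> S) :
  @measurable_fun _ _ (g_sigma_algebraType (past t)) _ setT Y ->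
  @measurable_fun _ _ (g_sigma_algebraType (hist t i)) _ setT Y.
Proof.
move=> mY _ B mB; have := mY measurableT B mB.
have sub : <<s past t >> `<=` <<s hist t i >>.
  by apply: sub_sigma_algebra2; exact: past_hist.
exact: sub.
Qed.

Let measurable_x_hist t i k j : (0 < t)%N ->
  @measurable_fun _ _ (g_sigma_algebraType (hist t i)) _ setT
    (fun w => x t.-1 w k 0 j).
Proof. by move=> t0; apply: measurable_hist; exact: measurable_x_past. Qed.

Let U t i := sub_sigma_mfun (@hist_measurable t i).
Let Upast t := sub_sigma_mfun (@past_measurable t).

Let indepU t i A B : (1 <= t <= T)%N -> measurable A -> measurable B ->
  (P (U t i @^-1` A `&` zeta i t @^-1` B) = P (U t i @^-1` A) * D i B)%E.
Proof. by move=> tT mA mB; exact: independent_hist. Qed.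

Let indepUpast t i A B : (1 <= t <= T)%N -> measurable A -> measurable B ->
  (P (Upast t @^-1` A `&` zeta i t @^-1` B) = P (Upast t @^-1` A) * D i B)%E.
Proof.
move=> tT mA mB; apply: independent_hist => //.
by move: mA; apply: sub_sigma_algebra2; exact: past_hist.
Qed.

Section Joint.
Context dS (S : measurableType dS) (Y : S -> 'rV[R]_m).
Hypothesis mY : forall j, measurable_fun setT (fun s => Y s 0 j).

Let mYfst i j : measurable_fun setT (fun p : S * Z i => Y p.1 0 j).
Proof. exact: (measurableT_comp (mY j) measurable_fst). Qed.

Lemma measurable_joint_grad i j : measurable_fun setT
  (fun p : S * Z i => grad (fun u => F i u p.2) (Y p.1) 0 j).
Proof. by apply: measurable_grad_sample => //; exact: measurable_snd. Qed.

Lemma measurable_joint_noise i j :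
  measurable_fun setT (fun p : S * Z i => noise i (Y p.1) p.2 0 j).
Proof.
under eq_fun do rewrite subr_entry.
apply: measurable_funB; first exact: measurable_joint_grad.
exact: measurable_local_grad.
Qed.

End Joint.

(** The sample of worker i at iteration t is independent of the point at which
    it is used, so a bound on the mean over D i that is uniform in the point
    passes to the iterate. *)
Lemma fresh_sample_le t i (Phi : 'rV[R]_m -> Z i -> R) (c : R) :
  (1 <= t <= T)%N -> (forall u z, 0 <= Phi u z) ->
  measurable_fun setT (fun p : g_sigma_algebraType (hist t i) * Z i =>
    Phi (x t.-1 p.1 i) p.2) ->
  (forall u, \int[D i]_z (Phi u z)%:E <= c%:E)%E ->
  (\int[P]_w (Phi (x t.-1 w i) (zeta i t w))%:E <= c%:E)%E.
Proof.
move=> tT Phi0 mPhi Phic.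
pose phi (p : g_sigma_algebraType (hist t i) * Z i) :=
  (Phi (x t.-1 p.1 i) p.2)%:E.
have mphi : measurable_fun setT phi by exact/measurable_EFinP.
have phi0 p : (0 <= phi p)%E by rewrite lee_fin.
have -> : (\int[P]_w (Phi (x t.-1 w i) (zeta i t w))%:E
         = \int[P]_w \int[D i]_z phi (U t i w, z))%E.
  apply: (ge0_integral_freeze (U := U t i) (V := zeta i t)) => // A B.
  exact: indepU.
rewrite -[leRHS](integral_probability_cst P).
apply: ge0_le_integral => //.
- by move=> w _; exact: integral_ge0.
- apply: (measurableT_comp (f := fun s => \int[D i]_z phi (s, z))%E) => //.
  exact: measurable_fun_fubini_tonelli_F.
- by move=> w _; exact: (Phic (x t.-1 w i)).
Qed.

Lemma noise_second_moment t i : (1 <= t <= T)%N ->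
  (\int[P]_w (dot (e t i w) (e t i w))%:E <= (sigma ^+ 2)%:E)%E.
Proof.
move=> tT; have t0 : (0 < t)%N by case/andP: tT.
apply: (@fresh_sample_le t i (fun u z =>
  dot (noise i u z) (noise i u z))) => //.
- by move=> u z; exact: dot_ge0.
- apply: measurable_dot => j;
  exact: (@measurable_joint_noise _ (g_sigma_algebraType (hist t i))
    (fun w => x t.-1 w i) (fun k => @measurable_x_hist t i i k t0)).
Qed.

Lemma sample_grad_second_moment t i : (1 <= t <= T)%N ->
  (\int[P]_w (dot (g t i w) (g t i w))%:E <= (G ^+ 2)%:E)%E.
Proof.
move=> tT; have t0 : (0 < t)%N by case/andP: tT.
apply: (@fresh_sample_le t i (fun u z =>
  dot (grad (fun u => F i u z) u) (grad (fun u => F i u z) u))) => //.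
- by move=> u z; exact: dot_ge0.
- apply: measurable_dot => j;
  exact: (@measurable_joint_grad _ (g_sigma_algebraType (hist t i))
    (fun w => x t.-1 w i) (fun k => @measurable_x_hist t i i k t0)).
Qed.

Let measurable_x t k j : measurable_fun setT (fun w => x t w k 0 j).
Proof.
apply: (@measurable_prsgd _ _ _ _ Omega (fun k s => zeta k s : Omega -> Z k)).
by move=> *; exact: measurable_funPT.
Qed.

Lemma sq_integrable_sample_grad t i j : (1 <= t <= T)%N ->
  sq_integrable P (fun w => g t i w 0 j).
Proof.
move=> tT; apply: sq_integrable_of_dot (sample_grad_second_moment i tT) _ => k.
exact: measurable_grad_sample.
Qed.

Lemma sq_integrable_local_grad (Y : Omega -> 'rV[R]_m) i j :
  (forall j, measurable_fun setT (fun w => Y w 0 j)) ->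
  sq_integrable P (fun w => df i (Y w) 0 j).
Proof.
move=> mY; apply: sq_integrable_bounded.
  exact: measurable_local_grad.
move=> w; apply: (le_trans (sqr_entry_le_dot _ _)); exact: local_grad_bound.
Qed.

Lemma sq_integrable_noise t i j : (1 <= t <= T)%N ->
  sq_integrable P (fun w => e t i w 0 j).
Proof.
move=> tT; under [X in sq_integrable _ X]eq_fun do rewrite subr_entry.
apply: sq_integrableB; first exact: sq_integrable_sample_grad.
exact: sq_integrable_local_grad.
Qed.

(** Unbiasedness says that the frozen mean of the noise vanishes almost surely
    given the samples of the earlier iterations. The frozen mean depends on
    them only, so the same holds given, in addition, the samples of the other
    workers at iteration t. *)
Lemma noise_orthogonal t i j (psi : Omega -> R) : (1 <= t <= T)%N ->
  @measurable_fun _ _ (g_sigma_algebraType (hist t i)) _ setT psi ->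
  sq_integrable P psi ->
  \int[P]_w (psi w * e t i w 0 j) = 0.
Proof.
move=> tT mpsi ipsi; have t0 : (0 < t)%N by case/andP: tT.
have [ig idf _ cond] := hunbiased i j tT.
have ie : integrable_fun P (fun w => e t i w 0 j).
  by apply: sq_integrable_integrable; exact: sq_integrable_noise.
have [A [mA A0 sA]] : {ae distribution P (Upast t), forall w,
    \int[D i]_z (noise i (x t.-1 w i) z 0 j)%:E = 0}%E.
  apply: (@frozen_mean_eq0 _ _ _ _ _ _ _ P (D i) (Upast t) (zeta i t) _
    (fun p => noise i (x t.-1 p.1 i) p.2 0 j)) => //.
  - by move=> A B; exact: indepUpast.
  - exact: (@measurable_joint_noise _ (g_sigma_algebraType (past t))
      (fun w => x t.-1 w i) (fun k => @measurable_x_past t i k t0)).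
  - move=> A mA.
    have sA : past_sigma (fun k s => zeta k s : Omega -> Z k) t A.
      by rewrite past_sigmaE.
    have mA' : measurable (Upast t @^-1` A).
      by rewrite -[_ @^-1` _]setTI; exact: (measurable_funPT (Upast t)).
    rewrite -[RHS](integral_sub_eq0 mA' ig idf (cond _ sA)).
    by apply: eq_integral => w _; rewrite subr_entry.
apply: (@frozen_mean_orthogonal _ _ _ _ _ _ _ P (D i) (U t i) (zeta i t) _
  (fun p => noise i (x t.-1 p.1 i) p.2 0 j)) => //.
- by move=> B C; exact: indepU.
- exact: (@measurable_joint_noise _ (g_sigma_algebraType (hist t i))
    (fun w => x t.-1 w i) (fun k => @measurable_x_hist t i i k t0)).
- by move=> w /=; exact: (@integrable_noise i (x t.-1 w i) j).
- exists A; split => //; move: mA; apply: sub_sigma_algebra2; exact: past_hist.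
- exact: (sq_integrable_mul ipsi (sq_integrable_noise i j tT)).
Qed.

(** Distinct workers have orthogonal noise, so averaging over the workers
    divides the second moment by N. *)
Lemma average_noise_second_moment t : (1 <= t <= T)%N ->
  \int[P]_w dot (average (fun i => e t i w)) (average (fun i => e t i w))
  <= sigma ^+ 2 / N%:R.
Proof.
move=> tT; have t0 : (0 < t)%N by case/andP: tT.
have N0 : 0 < N%:R :> R by rewrite ltr0n.
have ie i j := sq_integrable_noise i j tT.
have iee i k : integrable_fun P (fun w => dot (e t i w) (e t k w)).
  exact: integrable_dot.
have cross i k : i != k -> \int[P]_w dot (e t k w) (e t i w) = 0.
  move=> ik; rewrite Rintegral_sum; last first.
    by move=> j _; exact: sq_integrable_mul.
  rewrite big1// => j _; apply: noise_orthogonal => //.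
  under eq_fun do rewrite subr_entry.
  apply: (@measurable_funB _ (g_sigma_algebraType (hist t i))).
    apply: (@measurable_grad_sample _ (g_sigma_algebraType (hist t i))).
      by move=> l; exact: measurable_x_hist.
    apply: (measurable_generated_by (X := X) (k := (k, t))).
    rewrite /= mem_history /= t0 leqnn !andbT.
    by apply: contraNneq ik => -[->].
  apply: (@measurable_local_grad _ (g_sigma_algebraType (hist t i))) => l.
  exact: measurable_x_hist.
have EE w : dot (average (fun i => e t i w)) (average (fun i => e t i w)) =
    N%:R^-1 ^+ 2 * \sum_i \sum_k dot (e t k w) (e t i w).
  rewrite /average dotZl dotZr mulrA -expr2 dot_suml; congr (_ * _).
  by apply: eq_bigr => i _; rewrite dotC dot_suml.
under eq_Rintegral do rewrite EE.
rewrite RintegralZl//; last first.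
  by apply: integrable_fun_sum => i _; apply: integrable_fun_sum => k _.
rewrite Rintegral_sum; last by move=> i _; apply: integrable_fun_sum => k _.
have diag i : \int[P]_w (\sum_k dot (e t k w) (e t i w)) <= sigma ^+ 2.
  rewrite Rintegral_sum//.
  rewrite (bigD1 i)//= big1 ?addr0; last first.
    by move=> k ki; apply: cross; rewrite eq_sym.
  by apply: Rintegral_dot_le; exact: noise_second_moment.
(* N^-2 times N diagonal terms leaves one factor N^-1. *)
rewrite expr2 -mulrA mulrC ler_pdivrMr// mulrVK ?unitfE ?gt_eqF//.
rewrite ler_pdivrMl//.
apply: (le_trans (ler_sum _ (fun i _ => diag i))).
by rewrite sumr_const card_ord mulr_natl.
Qed.

Lemma average_noise_orthogonal t (V : Omega -> 'rV[R]_m) : (1 <= t <= T)%N ->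
  (forall i j, @measurable_fun _ _ (g_sigma_algebraType (hist t i)) _ setT
     (fun w => V w 0 j)) ->
  (forall j, sq_integrable P (fun w => V w 0 j)) ->
  \int[P]_w dot (V w) (average (fun i => e t i w)) = 0.
Proof.
move=> tT mV iV.
have VE w : dot (V w) (average (fun i => e t i w)) =
    N%:R^-1 * \sum_i dot (V w) (e t i w).
  rewrite /average dotZr dotC dot_suml; congr (_ * _).
  by apply: eq_bigr => i _; rewrite dotC.
have ie i j := sq_integrable_noise i j tT.
have iVe i : integrable_fun P (fun w => dot (V w) (e t i w)).
  exact: integrable_dot.
under eq_Rintegral do rewrite VE.
rewrite RintegralZl//; last by apply: integrable_fun_sum => i _.
rewrite Rintegral_sum; last by move=> i _.
rewrite big1 ?mulr0// => i _.
rewrite Rintegral_sum; last by move=> j _; exact: sq_integrable_mul.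
by rewrite big1// => j _; exact: noise_orthogonal.
Qed.

(** * The averaged gradient bound *)

Variables (L : R) (fstar : R).
Hypotheses (hL : 0 < L)
  (hsmooth : forall (i : 'I_N) (x y : 'rV[R]_m),
     enorm (grad (local_loss D F i) x - grad (local_loss D F i) y)
       <= L * enorm (x - y))
  (hfstar : is_minimum_value (global_loss D F) fstar)
  (hgamma0 : 0 < gamma) (hgammaL : gamma <= L^-1) (hI : (0 < I)%N).

Let f := global_loss D F.
Let xbar t w := average (x t w).
Let grad_xbar t w := average (fun i => df i (xbar t w)).
Let mean_noise t w := average (fun i => e t.+1 i w).
Let noise_coef t w :=
  L * gamma ^+ 2 *: average (fun i => df i (x t w i)) - gamma *: grad_xbar t w.
Let window_sum t w :=
  \sum_i \sum_(last_sync I t <= s < t.+1) dot (g s i w) (g s i w).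

(** The errors of [one_step], once [prsgd_spread] has traded the spread of the
    iterates for the gradients since the last averaging. *)
Let step_error t w :=
  gamma ^+ 3 * L ^+ 2 * I%:R / 2 / N%:R * window_sum t w
  + dot (noise_coef t w) (mean_noise t w)
  + L * gamma ^+ 2 / 2 * dot (mean_noise t w) (mean_noise t w).

Lemma grad_global u : grad f u = average (fun i => df i u).
Proof. exact: grad_mean. Qed.

(** Summing the one-step inequality along one realization, the values of f
    telescope and only f at the last mean iterate remains, which fstar bounds
    from below. *)
Lemma pathwise_bound w :
  gamma / 2 * \sum_(t < T) dot (grad_xbar t w) (grad_xbar t w) <=
  f (average (fun _ : 'I_N => y0)) - fstar +
  \sum_(t < T) step_error t w.
Proof.
have step t : gamma / 2 * dot (grad_xbar t w) (grad_xbar t w) <=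
    f (xbar t w) - f (xbar t.+1 w) + step_error t w.
  have := one_step hN hfdiff hL hsmooth (x := x t w) (g := fun i => g t.+1 i w)
    hgamma0 hgammaL erefl erefl erefl erefl.
  rewrite -/(xbar t w) -/(grad_xbar t w) -/(mean_noise t w) -/(noise_coef t w).
  rewrite -(average_prsgdS F gamma I y0 (fun k s => zeta k s w) hN t).
  rewrite -/(x t.+1 w) -/(xbar t.+1 w).
  have := prsgd_spread F gamma y0 (fun k s => zeta k s w) hN hI t.
  rewrite -/(x t w) -/(xbar t w) -/(window_sum t w).
  move: (\sum_i dot _ _) => spread spreadW step1; apply: (le_trans step1).
  rewrite /step_error -!addrA lerD2l lerD2l lerD2r.
  have c0 : 0 <= gamma * L ^+ 2 / 2 * N%:R^-1.
    by rewrite !mulr_ge0 ?invr_ge0 ?sqr_ge0// ltW.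
  rewrite mulrA; apply: (le_trans (ler_wpM2l c0 spreadW)).
  by rewrite le_eqVlt; apply/orP; left; apply/eqP; ring.
rewrite mulr_sumr; apply: (le_trans (ler_sum _ (fun (t : 'I_T) _ => step t))).
rewrite big_split/= lerD2r.
rewrite -(big_mkord xpredT (fun t => f (xbar t w) - f (xbar t.+1 w))).
under eq_bigr do rewrite -opprB.
rewrite sumrN telescope_sumr// opprB lerB//.
by case: hfstar => _; apply.
Qed.

Lemma sq_integrable_grad_xbar t j :
  sq_integrable P (fun w => grad_xbar t w 0 j).
Proof.
rewrite /grad_xbar /average.
under [X in sq_integrable _ X]eq_fun do rewrite scaler_entry summxE.
apply: sq_integrableZ; apply: sq_integrable_sum => i.
by apply: sq_integrable_local_grad; exact: measurable_average.
Qed.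

Lemma sq_integrable_noise_coef t j :
  sq_integrable P (fun w => noise_coef t w 0 j).
Proof.
under [X in sq_integrable _ X]eq_fun do
  rewrite subr_entry (scaler_entry (_ * _)) (scaler_entry gamma).
apply: sq_integrableB; apply: sq_integrableZ; last first.
  exact: sq_integrable_grad_xbar.
rewrite /average.
under [X in sq_integrable _ X]eq_fun do rewrite scaler_entry summxE.
apply: sq_integrableZ; apply: sq_integrable_sum => i.
exact: sq_integrable_local_grad.
Qed.

Lemma measurable_noise_coef t i j :
  @measurable_fun _ _ (g_sigma_algebraType (hist t.+1 i)) _ setT
    (fun w => noise_coef t w 0 j).
Proof.
have mx k l : @measurable_fun _ _ (g_sigma_algebraType (hist t.+1 i)) _ setT
    (fun w => x t w k 0 l) by exact: (@measurable_x_hist t.+1).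
under eq_fun do rewrite subr_entry (scaler_entry (_ * _))
  (scaler_entry gamma).
apply: (@measurable_funB _ (g_sigma_algebraType (hist t.+1 i)));
  apply: (@measurable_funM _ (g_sigma_algebraType (hist t.+1 i))) => //;
  apply: (@measurable_average _ (g_sigma_algebraType (hist t.+1 i))) => k l;
  apply: (@measurable_local_grad _ (g_sigma_algebraType (hist t.+1 i))) => // ?.
exact: (@measurable_average _ (g_sigma_algebraType (hist t.+1 i))).
Qed.

Lemma sq_integrable_mean_noise t j : (t < T)%N ->
  sq_integrable P (fun w => mean_noise t w 0 j).
Proof.
move=> tT; rewrite /mean_noise /average.
under [X in sq_integrable _ X]eq_fun do rewrite scaler_entry summxE.
apply: sq_integrableZ; apply: sq_integrable_sum => i.
exact: sq_integrable_noise.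
Qed.

Let dot_g_integrable s i : (1 <= s <= T)%N ->
  integrable_fun P (fun w => dot (g s i w) (g s i w)).
Proof.
by move=> sT; apply: integrable_dot => j; exact: sq_integrable_sample_grad.
Qed.

Let in_window t s : (t < T)%N -> s \in index_iota (last_sync I t) t.+1 ->
  (1 <= s <= T)%N.
Proof.
rewrite mem_index_iota geq_max ltnS => tT /andP[/andP[-> _] st].
exact: leq_trans (ltnW tT).
Qed.

Lemma integrable_window_sum t : (t < T)%N -> integrable_fun P (window_sum t).
Proof.
move=> tT; apply: integrable_fun_sum => i _; apply: integrable_fun_sum => s st.
exact: dot_g_integrable (in_window tT st).
Qed.

Lemma window_sum_mean t : (t < T)%N ->
  \int[P]_w window_sum t w <= N%:R * (I%:R * G ^+ 2).
Proof.
move=> tT; rewrite Rintegral_sum; last first.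
  move=> i _; apply: integrable_fun_sum => s st.
  exact: dot_g_integrable (in_window tT st).
have bound i :
    \int[P]_w (\sum_(last_sync I t <= s < t.+1) dot (g s i w) (g s i w))
    <= I%:R * G ^+ 2.
  rewrite Rintegral_sum; last first.
    by move=> s st; exact: dot_g_integrable (in_window tT st).
  apply: (@le_trans _ _ (\sum_(last_sync I t <= s < t.+1) G ^+ 2)).
    rewrite !big_seq; apply: ler_sum => s st; apply: Rintegral_dot_le.
    exact: sample_grad_second_moment (in_window tT st).
  rewrite sumr_const_nat -[leLHS]mulr_natl ler_wpM2r ?sqr_ge0// ler_nat.
  exact: leq_sub_last_sync.
apply: (le_trans (ler_sum _ (fun i _ => bound i))).
by rewrite sumr_const card_ord -[leLHS]mulr_natl.
Qed.

Lemma expectation_sq_grad t :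
  ('E_P[fun w => (enorm (grad f (xbar t w)) ^+ 2)%R]
   = (\int[P]_w dot (grad_xbar t w) (grad_xbar t w))%R%:E)%E.
Proof.
have iA : integrable_fun P (fun w => dot (grad_xbar t w) (grad_xbar t w)).
  by apply: integrable_dot => j; exact: sq_integrable_grad_xbar.
rewrite unlock /Rintegral fineK; last exact: integrable_fin_num iA.
by apply: eq_integral => w _; rewrite sqr_enorm grad_global.
Qed.

(** In expectation the one-step errors are the spread of the iterates, at most
    gamma^2 I^2 G^2 on average over the workers, the linear noise term, which
    vanishes, and the second moment sigma^2 / N of the mean noise. *)
Lemma mean_grad_bound : (0 < T)%N ->
  T%:R^-1 * \sum_(t < T) \int[P]_w dot (grad_xbar t w) (grad_xbar t w) <=
  2 / (gamma * T%:R) * (f (average (fun _ : 'I_N => y0)) - fstar)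
  + gamma ^+ 2 * I%:R ^+ 2 * G ^+ 2 * L ^+ 2 + L / N%:R * gamma * sigma ^+ 2.
Proof.
move=> T0; have T0' : 0 < T%:R :> R by rewrite ltr0n.
have N0 : 0 < N%:R :> R by rewrite ltr0n.
set C := _ - fstar; set c1 := gamma ^+ 3 * L ^+ 2 * I%:R / 2 / N%:R.
set c2 := L * gamma ^+ 2 / 2.
have c1_ge0 : 0 <= c1 by rewrite !mulr_ge0 ?invr_ge0 ?exprn_ge0 ?sqr_ge0// ltW.
have c2_ge0 : 0 <= c2 by rewrite !mulr_ge0 ?sqr_ge0// ltW.
have iA t : integrable_fun P (fun w => dot (grad_xbar t w) (grad_xbar t w)).
  by apply: integrable_dot => j; exact: sq_integrable_grad_xbar.
have iW (t : 'I_T) := integrable_window_sum (ltn_ord t).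
have iE (t : 'I_T) :
    integrable_fun P (fun w => dot (mean_noise t w) (mean_noise t w)).
  by apply: integrable_dot => j; exact: sq_integrable_mean_noise.
have iV (t : 'I_T) :
    integrable_fun P (fun w => dot (noise_coef t w) (mean_noise t w)).
  apply: integrable_dot => j; first exact: sq_integrable_noise_coef.
  exact: sq_integrable_mean_noise.
have i12 (t : 'I_T) : integrable_fun P (fun w =>
    c1 * window_sum t w + dot (noise_coef t w) (mean_noise t w)).
  exact: (integrable_funD (integrable_funZ c1 (iW t)) (iV t)).
have ierror (t : 'I_T) : integrable_fun P (step_error t).
  exact: (integrable_funD (i12 t) (integrable_funZ c2 (iE t))).
have error_mean (t : 'I_T) : \int[P]_w step_error t w <=
    c1 * (N%:R * (I%:R * G ^+ 2)) + c2 * (sigma ^+ 2 / N%:R).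
  have tT := ltn_ord t.
  rewrite RintegralD//; [|exact: i12|exact: integrable_funZ].
  rewrite RintegralD//; [|exact: integrable_funZ|exact: iV].
  rewrite !RintegralZl//; [|exact: iE|exact: iW].
  rewrite (average_noise_orthogonal (t := t.+1)
    (V := noise_coef t))//; first last.
  - by move=> j; exact: sq_integrable_noise_coef.
  - by move=> i j; exact: measurable_noise_coef.
  rewrite addr0; apply: lerD; rewrite ler_wpM2l//; first exact: window_sum_mean.
  exact: average_noise_second_moment.
have total :
    gamma / 2 * \sum_(t < T) \int[P]_w dot (grad_xbar t w) (grad_xbar t w) <=
    C + \sum_(t < T) \int[P]_w step_error t w.
  rewrite -Rintegral_sum// -Rintegral_sum//.
  rewrite -RintegralZl//; last by apply: integrable_fun_sum => t _.
  rewrite -[C in leRHS](Rintegral_probability_cst P) -RintegralD//; first last.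
  - by apply: integrable_fun_sum => t _.
  - exact: integrable_fun_cst.
  apply: le_Rintegral => //.
  - by apply: integrable_funZ; apply: integrable_fun_sum => t _.
  - apply: integrable_funD; first exact: integrable_fun_cst.
    by apply: integrable_fun_sum => t _.
  - by move=> w _; exact: pathwise_bound.
rewrite ler_pdivrMl//.
have := le_trans total (lerD (lexx C) (ler_sum _ (fun t _ => error_mean t))).
rewrite sumr_const card_ord -mulr_natl.
move: (\sum_(t < T) _) => Sm.
rewrite -ler_pdivlMl ?divr_gt0// => /le_trans; apply.
rewrite le_eqVlt; apply/orP; left; apply/eqP; rewrite /c1 /c2.
by field; rewrite !gt_eqF.
Qed.

End Noise.
End Problem.

Theorem theorem1 (R : realType) (N m : nat) (hN : (1 <= N)%N)
  (* data distributions and sample losses *)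
  (d : 'I_N -> measure_display) (Z : forall i : 'I_N, measurableType (d i))
  (D : forall i : 'I_N, probability (Z i) R)
  (F : forall i : 'I_N, 'rV[R]_m -> Z i -> R)
  (hFint : forall (i : 'I_N) (x : 'rV[R]_m),
     (D i).-integrable setT (fun z => (F i x z)%:E))
  (hFdiff : forall (i : 'I_N) (z : Z i) (x : 'rV[R]_m),
     differentiable (fun u => F i u z) x)
  (* smoothness *)
  (L : R) (hL : 0 < L)
  (hfdiff : forall (i : 'I_N) (x : 'rV[R]_m), differentiable (local_loss D F i) x)
  (hsmooth : forall (i : 'I_N) (x y : 'rV[R]_m),
     enorm (grad (local_loss D F i) x - grad (local_loss D F i) y)
       <= L * enorm (x - y))
  (* bounded variance and bounded second moment *)
  (sigma G : R) (hsigma : 0 < sigma) (hG : 0 < G)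
  (hvar : forall (i : 'I_N) (x : 'rV[R]_m),
     ('E_(D i)[fun z => (enorm (grad (fun u => F i u z) x
                                 - grad (local_loss D F i) x) ^+ 2)%R]
       <= (sigma ^+ 2)%:E)%E)
  (hmom : forall (i : 'I_N) (x : 'rV[R]_m),
     ('E_(D i)[fun z => (enorm (grad (fun u => F i u z) x) ^+ 2)%R]
       <= (G ^+ 2)%:E)%E)
  (fstar : R) (hfstar : is_minimum_value (global_loss D F) fstar)
  (* algorithm parameters *)
  (gamma : R) (hgamma0 : 0 < gamma) (hgammaL : gamma <= L^-1)
  (I : nat) (hI : (0 < I)%N) (y0 : 'rV[R]_m)
  (T : nat) (hT : (1 <= T)%N)
  (* the samples drawn at iterations 1, ..., T *)
  (dO : measure_display) (Omega : measurableType dO) (P : probability Omega R)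
  (zeta : forall i : 'I_N, nat -> {RV P >-> Z i})
  (hlaw : forall (i : 'I_N) (t : nat), (1 <= t <= T)%N ->
     forall B : set (Z i), measurable B -> distribution P (zeta i t) B = D i B)
  (hindep : mutually_independent P
     [set k : 'I_N * nat | (1 <= k.2 <= T)%N]
     (fun k : 'I_N * nat => zeta k.1 k.2 : Omega -> Z k.1))
  (* unbiased stochastic gradients *)
  (hunbiased : forall (i : 'I_N) (t : nat) (j : 'I_m), (1 <= t <= T)%N ->
     let x := fun w => prsgd F gamma I y0 (fun k s => zeta k s w) t.-1 i in
     is_cond_expectation P (past_sigma (fun k s => zeta k s : Omega -> Z k) t)
       (fun w => grad (fun u => F i u (zeta i t w)) (x w) 0 j)
       (fun w => grad (local_loss D F i) (x w) 0 j)) :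
  let f := global_loss D F in
  let xbar := fun (t : nat) (w : Omega) =>
    average (prsgd F gamma I y0 (fun k s => zeta k s w) t) in
  ((T%:R^-1)%:E *
     \sum_(1 <= t < T.+1) 'E_P[fun w => (enorm (grad f (xbar t.-1 w)) ^+ 2)%R]
   <= (2 / (gamma * T%:R) * (f (average (fun _ : 'I_N => y0)) - fstar)
       + 4 * gamma ^+ 2 * I%:R ^+ 2 * G ^+ 2 * L ^+ 2
       + L / N%:R * gamma * sigma ^+ 2)%R%:E)%E.
Proof.
cbv zeta; rewrite big_add1 big_mkord /=.
under eq_bigr => t _ do
  rewrite (expectation_sq_grad hFint hFdiff hfdiff hvar hmom).
rewrite sumEFin -EFinM lee_fin.
apply: le_trans (mean_grad_bound hN hFint hFdiff hfdiff hvar hmom hlaw hindep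
  hunbiased hL hsmooth hfstar hgamma0 hgammaL hI hT) _.
(* The spread estimate holds with the constant 1 where 4 is claimed. *)
by rewrite lerD2r lerD2l -!mulrA ler_peMl// ?mulr_ge0 ?exprn_ge0//; lra.
Qed.
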